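(* Consider the parametric model $Y_{it}=g_t(X_{it},U_{it};\theta_0)$, $i=1,\dots,n$, $t=1,2$, with i.i.d. observations over $i$, $\theta_0\in\Theta\subset\mathbb{R}^{d_\theta}$, and $D_\theta$, $\hat D_{n,\theta}$, $\|\cdot\|_\mu$ as defined in the context. Suppose: (P1) for $t=1,2$, $g_t(x,u;\theta)$ is continuous and strictly increasing in $u$ for all $\theta\in\Theta$, and $U_{it}$ given $\mathbf{X}_i=\mathbf{x}$ is continuously distributed for all $\mathbf{x}$; (P2) for $t=1,2$ and all $\mathbf{x}\in\mathcal{X}_{12}$, the conditional distribution function of $Y_{it}$ given $\mathbf{X}_i=\mathbf{x}$ is continuous, and strictly increasing on its conditional support; (P3) for some $\bar{x}\in\mathcal{X}_1$, $g_1(\bar{x},u;\theta)=u$ for all $u\in\mathcal{U}$, $\theta\in\Theta$; and for all $\theta\ne\theta'$ in $\Theta$, $g_t(\cdot,\cdot;\theta)\neq g_t(\cdot,\cdot;\theta')$ for some $t$; (P4) for all $\mathbf{x}\in\mathcal{X}_{12}$, $U_{i1}$ and $U_{i2}$ have the same conditional distribution given $\mathbf{X}_i=\mathbf{x}$, and the support of $U_{it}$ given $\mathbf{X}_i=\mathbf{x}$ is $\mathcal{U}$; (C1) $\hat\theta_n\in\Theta$ satisfies $\|\hat D_{n,\hat\theta_n}\|_\mu=\inf_{\theta\in\Theta}\|\hat D_{n,\theta}\|_\mu$; (C2) $\Theta$ is compact; (C3) for all $\theta,\theta'\in\Theta$ (and all $t,x,u$), $|g_t(x,u;\theta')-g_t(x,u;\theta)|\le\bar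 g(x)\|\theta'-\theta\|$ for some strictly positive function $\bar g$ with $E[\bar g(X_t)]\le K$, where $0<K<\infty$; (C4) for $t=1,2$, $Y_{it}$ is absolutely continuously distributed given $\mathbf{X}_i$, with a conditional density $f_{Y_t|\mathbf{X}}(y|\mathbf{x})$ that is uniformly bounded above and continuous in $y$; (C5) for $t=1,2$, there exist an integer $J_t$ and functions $\{\beta_j\}_{j=1}^{J_t}$ (which may depend on $t$) such that for every $\theta\in\Theta$ and $u\in\mathcal{U}$ there is $\alpha^t(\theta,u)\in\mathbb{R}^{J_t}$ with $g_t(x,u;\theta)=\sum_{j=1}^{J_t}\alpha^t_j(\theta,u)\beta_j(x)$ for all $x$; (Identification) for $\theta\in\Theta$: $\|D_\theta\|_\mu=0$ if and only if $\theta=\theta_0$. Then $\hat\theta_n\to\theta_0$ almost surely as $n\to\infty$.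
   Context: $W_i=(Y_{i1},Y_{i2},X_{i1},X_{i2})$ are i.i.d. copies of $W=(Y_1,Y_2,X_1,X_2)$, $Y_t\in\mathbb{R}$, $X_t\in\mathbb{R}^k$, $\mathbf{X}=(X_1,X_2)$; $U_{it}\in\mathbb{R}$ is unobserved. $\mathcal{X}_t$, $\mathcal{X}_{12}$ are the supports of $X_t$ and $(X_1,X_2)$, $\mathcal{U}$ is the common support of $U_1,U_2$. $\mathcal{V}=\mathcal{X}_{12}\times\mathcal{U}$, with elements $v=(v_{\mathbf{x}},v_u)$. Vector inequalities are componentwise. For $w=(y_1,y_2,x_1,x_2)$, $\mathbf{x}=(x_1,x_2)$, $$A_\theta^v(w)=\left[\mathbf{1}\{y_1\le g_1(x_1,v_u;\theta)\}-\mathbf{1}\{y_2\le g_2(x_2,v_u;\theta)\}\right]\mathbf{1}\{\mathbf{x}\le v_{\mathbf{x}}\},$$ $D_\theta(v)=E[A_\theta^v(W)]$ and $\hat D_{n,\theta}(v)=\frac1n\sum_{i=1}^nA_\theta^v(W_i)$. $\mu$ is a fixed probability measure with support $\mathcal{V}$ and $\|f\|_\mu=(\int f(v)^2d\mu(v))^{1/2}$. *)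

(* Defs.v *)
From HB Require Import structures.
From mathcomp Require Export all_boot all_order all_algebra.
From mathcomp Require Export all_classical all_reals all_analysis.

Set Implicit Arguments.
Unset Strict Implicit.
Unset Printing Implicit Defensive.

Import Order.TTheory GRing.Theory Num.Theory.
Import numFieldNormedType.Exports.

Local Open Scope classical_set_scope.
Local Open Scope ring_scope.

(* The library puts no sigma-algebra on matrices; this is the Borel one, used
   for 'rV[R]_k = R^k. *)
Section borel_matrix.
Context (R : realType) (m n : nat).
Let G : set (set 'M[R]_(m, n)) := open.

HB.instance Definition _ := @isMeasurable.Build (sigma_display G) 'M[R]_(m, n)
  <<s G >> (@sigma_algebra0 _ setT G) (@sigma_algebraC _ G)
  (@sigma_algebra_bigcup _ setT G).

End borel_matrix.

(* The periods t = 1, 2, as the elements 0, 1 of 'I_2. *)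
Definition t1 : 'I_2 := ord0.
Definition t2 : 'I_2 := ord_max.

(* The closed support: the points all of whose open neighbourhoods are charged. *)
Definition support (R : realType) (T : topologicalType) (m : set T -> \bar R) :
  set T := [set x | forall O, open O -> O x -> (0 < m O)%E].

Definition euclidean_norm (R : realType) (d : nat) (x : 'rV[R]_d) : R :=
  Num.sqrt (\sum_(j < d) x ord0 j ^+ 2).

Section probability.
Context (R : realType) (d d1 d2 : measure_display) (Omega : measurableType d)
  (T1 : measurableType d1) (T2 : measurableType d2) (P : probability Omega R).

Definition mutually_independent (W : nat -> Omega -> T1) : Prop :=
  forall (s : seq nat) (B : nat -> set T1), uniq s ->
    (forall i, measurable (B i)) ->
    P (\bigcap_(i in [set` s]) (W i @^-1` B i)) =
    (\prod_(i <- s) P (W i @^-1` B i))%E.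

Definition identically_distributed (W : nat -> Omega -> T1) : Prop :=
  forall (i j : nat) (B : set T1), measurable B ->
    P (W i @^-1` B) = P (W j @^-1` B).

(* kappa is a regular version of the conditional distribution of Z given X:
   P(X in A, Z in B) = E[1{X in A} kappa(X, B)]. *)
Definition is_cond_distribution (X : Omega -> T1) (Z : Omega -> T2)
    (kappa : R.-pker T1 ~> T2) : Prop :=
  forall (A : set T1) (B : set T2), measurable A -> measurable B ->
    P ((X @^-1` A) `&` (Z @^-1` B)) = (\int[P]_(w in X @^-1` A) kappa (X w) B)%E.

End probability.

Definition dist_fun (R : realType) (m : set R -> \bar R) (y : R) : R :=
  fine (m `]-oo, y]%classic).

Section panel.
Context (R : realType) (k dt : nat).

(* The observation (Y_1, Y_2, X_1, X_2) is encoded as ((Y_1, Y_2), (X_1, X_2)),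
   and v = (v_x, v_u) as ((v_x1, v_x2), v_u). *)
Local Notation obs := ((R * R) * ('rV[R]_k * 'rV[R]_k))%type.
Local Notation point := (('rV[R]_k * 'rV[R]_k) * R)%type.

Definition le_vec (x y : 'rV[R]_k) : bool :=
  [forall j, x ord0 j <= y ord0 j].

Definition A_moment (g : 'I_2 -> 'rV[R]_k -> R -> 'rV[R]_dt -> R)
    (theta : 'rV[R]_dt) (v : point) (w : obs) : R :=
  ((w.1.1 <= g t1 w.2.1 v.2 theta)%R%:R - (w.1.2 <= g t2 w.2.2 v.2 theta)%R%:R)
  * (le_vec w.2.1 v.1.1 && le_vec w.2.2 v.1.2)%:R.

Context (d : measure_display) (Omega : measurableType d)
  (P : probability Omega R).

Definition pairX (X : nat -> 'I_2 -> {RV P >-> 'rV[R]_k}) (i : nat)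
    (omega : Omega) : 'rV[R]_k * 'rV[R]_k :=
  (X i t1 omega, X i t2 omega).

Definition obsW (Y : nat -> 'I_2 -> {RV P >-> R})
    (X : nat -> 'I_2 -> {RV P >-> 'rV[R]_k}) (i : nat) (omega : Omega) : obs :=
  ((Y i t1 omega, Y i t2 omega), pairX X i omega).

(* [fine] is harmless in D_pop: A_moment is bounded by 1. *)
Definition D_pop (g : 'I_2 -> 'rV[R]_k -> R -> 'rV[R]_dt -> R)
    (W : Omega -> obs) (theta : 'rV[R]_dt) (v : point) : R :=
  fine ('E_P[fun omega => A_moment g theta v (W omega)])%E.

(* The sample is W 0, ..., W (n - 1). *)
Definition D_hat (g : 'I_2 -> 'rV[R]_k -> R -> 'rV[R]_dt -> R)
    (W : nat -> Omega -> obs) (n : nat) (omega : Omega) (theta : 'rV[R]_dt)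
    (v : point) : R :=
  n%:R^-1 * \sum_(i < n) A_moment g theta v (W i omega).

Definition norm_mu (mu : probability point R) (f : point -> R) : \bar R :=
  ('N[mu]_(2%:E) [EFin \o f])%E.

End panel.

(* Main.v *)
(* No uniform law of large numbers over theta and v is needed, only one for the
   integrated square |.|_mu^2.  For a measurable H, the error
   n^-1 sum_i 1_H(v, W_i) - P(W in H_v) has variance at most 1/n for each v, so by
   Tonelli its integrated square has mean at most 1/n, and it tends to 0 almost
   surely.  By (C3), for |theta' - theta| <= delta the indicators of
   {y_t <= g_t(x_t, v_u; theta')} and {y_t <= g_t(x_t, v_u; theta)} differ only on
   the tube {|y_t - g_t(x_t, v_u; theta)| <= gbar(x_t) delta}, whose probability
   is at most 2 M K delta by (C4), uniformly in v.  Applying the law of large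
   numbers to the countably many sets and tubes attached to a countable dense
   family of parameters, almost surely every cluster point theta* of thetahat_n
   satisfies |D_theta*|_mu = 0, so theta* = theta0, and compactness concludes. *)

Require Import Defs.
From mathcomp Require Import ring lra zify measurable_realfun.

Set Implicit Arguments.
Unset Strict Implicit.
Unset Printing Implicit Defensive.

Import Order.TTheory GRing.Theory Num.Theory.
Import numFieldNormedType.Exports.

Local Open Scope classical_set_scope.
Local Open Scope ring_scope.

(** * Variance of an average of indicators *)

Section indicator_average.
Context (R : realType) (d : measure_display) (T : measurableType d)
  (P : probability T R).

Lemma integrable_bounded_probability (M : R) (f : T -> R) :
  measurable_fun setT f -> (forall x, `|f x| <= M) ->
  P.-integrable setT (EFin \o f).
Proof.
move=> mf fM; apply: measurable_bounded_integrable => //.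
  by rewrite ltey_eq fin_num_measure.
by exists M; split; [exact: num_real|move=> N MN x _; exact: le_trans (fM x) (ltW MN)].
Qed.

(** The covariance of two indicators of equal mean: expanding the product gives
    [P (A]&[B) - 2 p * p + p ^+ 2]. For [A = B] it becomes the variance [p - p ^+ 2], and for
    independent events it vanishes. *)
Lemma integral_prod_centered_indic (p : R) (A B : set T) :
  measurable A -> measurable B -> P A = p%:E -> P B = p%:E ->
  (\int[P]_x (((\1_A x - p) * (\1_B x - p))%:E) = P (A `&` B) - (p ^+ 2)%:E)%E.
Proof.
move=> mA mB PA PB.
pose c : R := - p; pose e : R := p ^+ 2.
have intI C : measurable C -> P.-integrable setT (EFin \o (\1_C : T -> R)).
  move=> mC; apply: (@integrable_bounded_probability 1).
    exact: measurable_indic.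
  by move=> x; rewrite indicE; case: (_ \in _); rewrite ?normr1 ?normr0.
have EI C : measurable C -> (\int[P]_x (\1_C x)%:E = P C)%E.
  by move=> mC; rewrite integral_indic ?setIT.
have mI : measurable (A `&` B) by exact: measurableI.
have iAB := intI _ mI.
have iA : P.-integrable setT (fun x => (c%:E * (\1_A x)%:E)%E).
  exact/integrableZl/intI.
have iB : P.-integrable setT (fun x => (c%:E * (\1_B x)%:E)%E).
  exact/integrableZl/intI.
have ie : P.-integrable setT (EFin \o cst e).
  by apply: (@integrable_bounded_probability `|e|).
transitivity (\int[P]_x ((\1_(A `&` B) x)%:E + (c%:E * (\1_A x)%:E)
    + (c%:E * (\1_B x)%:E) + (EFin \o cst e) x))%E.
  apply: eq_integral => x _.
  by rewrite -!EFinM -!EFinD indicI /=; congr _%:E; rewrite /c /e; ring.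
have iABA := integrableD measurableT iAB iA.
have iABB := integrableD measurableT iABA iB.
rewrite (integralD measurableT iABB ie) (integralD measurableT iABA iB).
rewrite (integralD measurableT iAB iA).
rewrite !integralZl//; [|exact: intI|exact: intI].
rewrite EI// !EI// PA PB -[X in (_ + X)%E]/(\int[P]_x cst e%:E x)%E.
rewrite integral_cst//= probability_setT mule1 -!addeA.
congr (_ + _)%E; rewrite -!EFinM -!EFinD; congr _%:E.
by rewrite /c /e; ring.
Qed.

(** Pairwise independence removes every off-diagonal covariance. The [n] diagonal ones contribute
    [p - p ^+ 2] each, at most 1, against the normalisation [n ^- 2]. *)
Lemma variance_indic_average (p : R) (B : nat -> set T) (n : nat) :
  (0 < n)%N -> (forall i, measurable (B i)) -> (forall i, P (B i) = p%:E) ->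
  (forall i j, i != j -> P (B i `&` B j) = (p ^+ 2)%:E) ->
  (\int[P]_x ((n%:R^-1 * (\sum_(i < n) \1_(B i) x) - p) ^+ 2)%:E
    <= (n%:R^-1)%:E)%E.
Proof.
move=> n0 mB PB PBB.
have p0 : 0 <= p by rewrite -lee_fin -(PB 0%N).
have p1 : p <= 1 by rewrite -lee_fin -(PB 0%N) probability_le1.
have nn0 : n%:R != 0 :> R by rewrite pnatr_eq0 -lt0n.
have mf i j : measurable_fun setT
    (fun x => (\1_(B i) x - p) * (\1_(B j) x - p) : R).
  by apply: measurable_funM; apply: measurable_funB => //;
    exact: measurable_indic.
have int2 (i j : nat) : P.-integrable setT
    (fun x => ((\1_(B i) x - p) * (\1_(B j) x - p))%:E).
  apply: (@integrable_bounded_probability 1) => // x.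
  rewrite normrM mulr_ile1// !indicE ler_norml.
    by case: (_ \in _); rewrite /=; lra.
  by case: (_ \in _); rewrite /=; lra.
(* [F i] is row [i] of the expanded square of the centered sum; summing the rows gives [G], so the
   integrand is [G] divided by [n ^+ 2]. *)
pose F i x := (\sum_(j < n) ((\1_(B i) x - p) * (\1_(B j) x - p))%:E)%E.
have intF i : P.-integrable setT (F i) by apply: integrable_sum.
pose G x := (\sum_(i < n) F i x)%E.
have intG : P.-integrable setT G by apply: integrable_sum.
rewrite (eq_integral (fun x => (n%:R^-2)%:E * G x)%E); last first.
  move=> x _; rewrite /G /F.
  under [in RHS]eq_bigr do rewrite sumEFin -mulr_sumr.
  rewrite sumEFin -mulr_suml -EFinM; congr _%:E.
  rewrite -exprVn !sumrB !big_const_ord !iter_addr_0 -expr2 -exprMn.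
  congr (_ ^+ 2); by rewrite mulrBr -(mulr_natl p) mulrA mulVf// mul1r.
rewrite integralZl// integral_sum//.
rewrite (eq_bigr (fun i : 'I_n => (p - p ^+ 2)%:E)); last first.
  move=> i _; rewrite integral_sum// (bigD1 i)//= big1 ?adde0.
    by rewrite integral_prod_centered_indic// setIid PB.
  move=> j ji; rewrite integral_prod_centered_indic// PBB ?subee//.
  by rewrite eq_sym.
rewrite sumEFin big_const_ord iter_addr_0 -EFinM lee_fin.
rewrite -(mulr_natl (p - p ^+ 2)) -exprVn expr2 -mulrA (mulrA n%:R^-1 n%:R) mulVf// mul1r.
rewrite ler_piMr ?invr_ge0//; nra.
Qed.

End indicator_average.

(** * The squared L2 norm *)

Section square_integral.
Context (R : realType) (d : measure_display) (T : measurableType d)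
  (mu : probability T R).

(** The squared norm is used instead of the norm because Tonelli applies to it directly. *)
Definition l2sq (f : T -> R) : \bar R := (\int[mu]_v ((f v) ^+ 2)%:E)%E.

Lemma l2sq_ge0 (f : T -> R) : (0 <= l2sq f)%E.
Proof. by apply: integral_ge0 => v _; rewrite lee_fin sqr_ge0. Qed.

Lemma measurable_sqr_EFin (f : T -> R) :
  measurable_fun setT f -> measurable_fun setT (fun v => ((f v) ^+ 2)%:E).
Proof. by move=> mf; apply/measurable_EFinP/measurable_funX. Qed.

Lemma l2sq_cst (c : R) : l2sq (cst c) = (c ^+ 2)%:E.
Proof.
rewrite /l2sq -[LHS]/(\int[mu]_x cst (c ^+ 2)%:E x)%E.
by rewrite integral_cst//= probability_setT mule1.
Qed.

(** Cauchy-Schwarz against the all-ones vector. The induction step, multiplied by the length [n] of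
    the tail, reduces to [(S - n * a i) ^+ 2 >= 0]; the empty tail is split off so that [n] is
    positive. *)
Lemma sqr_sum_le (I : Type) (s : seq I) (a : I -> R) :
  (\sum_(i <- s) a i) ^+ 2 <= (size s)%:R * \sum_(i <- s) (a i) ^+ 2.
Proof.
elim: s => [|i s IH]; first by rewrite !big_nil expr2 !mulr0.
rewrite !big_cons [size _]/= -natr1.
case: s IH => [|j s] IH; first by rewrite !big_nil /= add0r mul1r !addr0.
move: IH; set S := \sum_(_ <- _) _; set Q := \sum_(_ <- _) _.
set n := (size _)%:R => IH.
have n1 : 1 <= n :> R by rewrite ler1n.
have n0 : 0 < n := lt_le_trans ltr01 n1.
rewrite -(ler_pM2l n0).
have := sqr_ge0 (S - n * a i); have := ler_wpM2l (ltW n0) IH.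
lra.
Qed.

(** A substitute for the triangle inequality at the level of squared norms; the price is the factor
    [size s]. *)
Lemma l2sq_le_sum (I : Type) (s : seq I) (h : I -> T -> R) (f : T -> R) :
  measurable_fun setT f -> (forall i, measurable_fun setT (h i)) ->
  {ae mu, forall v, `|f v| <= \sum_(i <- s) `|h i v|} ->
  (l2sq f <= (size s)%:R%:E * \sum_(i <- s) l2sq (h i))%E.
Proof.
move=> mf mh fh.
have mh2 i := measurable_sqr_EFin (mh i).
have h20 i v : (0 <= ((h i v) ^+ 2)%:E)%E by rewrite lee_fin sqr_ge0.
rewrite -(ge0_integral_sum mu measurableT mh2)//.
rewrite -ge0_integralZl//; last 2 first.
- exact: emeasurable_sum.
- by move=> v _; exact: sume_ge0.
apply: ae_ge0_le_integral => //.
- by move=> v _; rewrite lee_fin sqr_ge0.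
- exact: measurable_sqr_EFin.
- by move=> v _; rewrite mule_ge0// sume_ge0.
- by apply: measurable_funeM; exact: emeasurable_sum.
apply: filterS fh => v fh _; rewrite sumEFin -EFinM lee_fin.
rewrite -real_normK ?num_real//.
apply: (le_trans (lerXn2r 2 _ _ fh)); rewrite ?nnegrE ?sumr_ge0//.
rewrite (le_trans (sqr_sum_le _ _))//; under eq_bigr do rewrite real_normK ?num_real//.
by [].
Qed.

End square_integral.

(** * Passage from sample sizes that are squares to all sample sizes *)

Section square_subsequence.
Context (R : realType).

Lemma sum_inv_sqr_le2 (n : nat) :
  \sum_(0 <= k < n) ((k.+1 ^ 2)%:R^-1 : R) <= 2.
Proof.
(* The bound 2 alone is not inductive. The sharper one is, since
   [(x + 1) ^- 2 <= x^-1 - (x + 1)^-1]. *)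
suff: \sum_(0 <= k < n.+1) ((k.+1 ^ 2)%:R^-1 : R) <= 2 - n.+1%:R^-1.
  rewrite big_nat_recr//= => h.
  rewrite (le_trans _ (le_trans h _))// ?lerDl ?invr_ge0//.
  by rewrite gerBl invr_ge0.
elim: n => [|n IH]; first by rewrite big_nat1 exp1n invr1; lra.
rewrite big_nat_recr//= (le_trans (lerD IH (lexx _)))//.
rewrite natrX -(natr1 n.+1); set x : R := n.+1%:R.
have x0 : 0 < x by rewrite ltr0n.
rewrite -subr_ge0.
have -> : 2 - (x + 1)^-1 - (2 - x^-1 + (x + 1) ^- 2) = (x * (x + 1) ^+ 2)^-1.
  by field; rewrite !gt_eqF//; lra.
by rewrite invr_ge0 mulr_ge0 ?sqr_ge0// ltW.
Qed.

Lemma nneseries_cvg0_near (f : nat -> \bar R) (e : R) :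
  (forall k, 0 <= f k)%E -> (\sum_(0 <= k <oo) f k < +oo)%E -> 0 < e ->
  \forall k \near \oo, (f k < e%:E)%E.
Proof.
move=> f0 foo e0.
have tail0 := nneseries_tail_cvg foo (fun k _ => f0 k).
have : \forall N \near \oo, (\sum_(N <= k <oo) f k < e%:E)%E.
  by apply: (tail0 [set u | (u < e%:E)%E]); apply: open_ereal_lt'; rewrite lte_fin.
apply: filterS => k; apply: le_lt_trans.
rewrite (le_trans _ (nneseries_lim_ge k.+1 _))//.
by rewrite big_nat1.
Qed.

(** With [S] the sum of the first [N] terms and [D] that of the others, the difference of averages
    is [(N * D - (m - N) * S) / (N * m)], where [0 <= S <= N] and [0 <= D <= m - N]. *)
Lemma average_diff_le (b : nat -> R) (N m : nat) :
  (forall i, 0 <= b i <= 1) -> (0 < N <= m)%N ->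
  `|m%:R^-1 * (\sum_(i < m) b i) - N%:R^-1 * (\sum_(i < N) b i)|
    <= (m - N)%:R / N%:R.
Proof.
move=> b01 /andP[N0 Nm].
rewrite -(big_mkord predT b) -(big_mkord predT b) (big_cat_nat _ Nm)//=.
set S := \sum_(0 <= i < N) _; set D := \sum_(N <= i < m) _.
have S0 : 0 <= S by apply: sumr_ge0 => i _; case/andP: (b01 i).
have D0 : 0 <= D by apply: sumr_ge0 => i _; case/andP: (b01 i).
have sum1 p q : \sum_(p <= i < q) b i <= (q - p)%:R.
  rewrite -[leRHS]mulr_natl mulr1 -[(q - p)%:R]/(1 *+ (q - p)) -sumr_const_nat.
  by apply: ler_sum => i _; case/andP: (b01 i).
have SN : S <= N%:R by rewrite (le_trans (sum1 _ _))// subn0.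
have := sum1 N m; rewrite -/D natrB//.
have Nm' : (N%:R <= m%:R :> R) by rewrite ler_nat.
have : 0 < N%:R :> R by rewrite ltr0n.
move: Nm' SN; set x : R := N%:R; set y : R := m%:R => xy Sx x0 Dxy.
have y0 : 0 < y by exact: lt_le_trans xy.
have -> : y^-1 * (S + D) - x^-1 * S = (x * D - (y - x) * S) / (x * y).
  by field; rewrite !gt_eqF.
rewrite normrM normfV (gtr0_norm (mulr_gt0 x0 y0)) ler_pdivrMr ?mulr_gt0//.
have -> : (y - x) / x * (x * y) = (y - x) * y by field; rewrite gt_eqF.
by rewrite ler_norml; nra.
Qed.

(** [k] is the integer square root of [n], obtained as the largest number whose square is at most
    [n]. *)
Lemma between_squares (K n : nat) : (K ^ 2 <= n)%N ->
  exists2 k, (K <= k)%N & (k ^ 2 <= n < k.+1 ^ 2)%N.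
Proof.
move=> Kn; have ub j : (j ^ 2 <= n)%N -> (j <= n)%N.
  by move=> jn; rewrite (leq_trans _ jn)// expnS expn1; case: j {jn} => // j; rewrite leq_pmulr.
have exK : exists j, (j ^ 2 <= n)%N by exists K.
case: (ex_maxnP exK ub) => k kn kmax; exists k; first exact: kmax.
by rewrite kn ltnNge; apply/negP => /kmax; rewrite ltnn.
Qed.

End square_subsequence.

(** * A strong law of large numbers in mean square *)

Section integrated_slln.
Context (R : realType) (d d1 d2 : measure_display) (Omega : measurableType d)
  (T1 : measurableType d1) (T2 : measurableType d2)
  (P : probability Omega R) (mu : probability T2 R) (W : nat -> Omega -> T1).

(** [H] is a family of events indexed by [v], kept as one set of pairs so that joint measurability,
    which Tonelli needs, is a single hypothesis on [H]. *)
Definition sample_mean (H : set (T2 * T1)) (n : nat) (omega : Omega) (v : T2) : R :=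
  n%:R^-1 * \sum_(i < n) \1_H (v, W i omega).

Definition pop_mean (H : set (T2 * T1)) (v : T2) : R :=
  fine (P [set omega | H (v, W 0%N omega)]).

Hypothesis mW : forall i, measurable_fun setT (W i).

Lemma measurable_event (H : set (T2 * T1)) (i : nat) :
  measurable H -> measurable [set vo : T2 * Omega | H (vo.1, W i vo.2)].
Proof.
move=> mH; rewrite -[X in measurable X]setTI.
have : measurable_fun setT (fun vo : T2 * Omega => (vo.1, W i vo.2)).
  by apply: measurable_fun_pair => //; apply: measurableT_comp.
exact.
Qed.

Lemma measurable_slice (H : set (T2 * T1)) (i : nat) (v : T2) :
  measurable H -> measurable [set omega | H (v, W i omega)].
Proof.
move=> /(measurable_event i) /(measurable_xsection v).
by congr measurable; apply/seteqP; split => omega; rewrite /xsection/= inE.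
Qed.

Lemma measurable_pop_mean (H : set (T2 * T1)) :
  measurable H -> measurable_fun setT (pop_mean H).
Proof.
move=> mH; have := measurable_fun_xsection P (measurable_event 0 mH).
move=> mf; apply: (eq_measurable_fun (fine \o (P \o
  xsection [set vo : T2 * Omega | H (vo.1, W 0%N vo.2)]))).
  move=> v _; rewrite /pop_mean /=; congr (fine (P _)).
  by apply/seteqP; split => omega; rewrite /xsection/= inE.
exact: measurableT_comp.
Qed.

Lemma measurable_sample_mean2 (H : set (T2 * T1)) (n : nat) : measurable H ->
  measurable_fun setT (fun vo : T2 * Omega => sample_mean H n vo.2 vo.1).
Proof.
move=> mH; apply: measurable_funM => //; apply: measurable_sum => i.
have := @measurable_indic _ _ R setT _ (measurable_event i mH).
by apply: eq_measurable_fun => vo _; rewrite !indicE; congr (_%:R); apply/idP/idP; rewrite !inE.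
Qed.

Lemma measurable_sample_mean (H : set (T2 * T1)) (n : nat) (omega : Omega) :
  measurable H -> measurable_fun setT (sample_mean H n omega).
Proof.
by move=> mH; apply: (measurable_fun_pair1 omega (measurable_sample_mean2 n mH)).
Qed.

Hypothesis indepW : mutually_independent P W.
Hypothesis identW : identically_distributed P W.

Lemma pairwise_independent (i j : nat) (A B : set T1) :
  i != j -> measurable A -> measurable B ->
  P ((W i @^-1` A) `&` (W j @^-1` B)) = (P (W i @^-1` A) * P (W j @^-1` B))%E.
Proof.
move=> ij mA mB.
have := indepW (s := [:: i; j]) (B := fun l => if l == i then A else B).
rewrite /= inE ij => /(_ isT) h.
have mAB : forall l, measurable (if l == i then A else B) by move=> l; case: ifP.
move: (h mAB); rewrite bigcap_seq !big_cons !big_nil setIT mule1 eqxx.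
by rewrite eq_sym (negbTE ij).
Qed.

Variable H : set (T2 * T1).
Hypothesis mH : measurable H.

Let F (n : nat) (omega : Omega) : \bar R :=
  l2sq mu (fun v => sample_mean H n omega v - pop_mean H v).

Let measurable_error (n : nat) : measurable_fun setT
  (fun vo : T2 * Omega => sample_mean H n vo.2 vo.1 - pop_mean H vo.1).
Proof.
apply: measurable_funB; first exact: measurable_sample_mean2.
by apply: measurableT_comp => //; exact: measurable_pop_mean.
Qed.

Let measurable_F (n : nat) : measurable_fun setT (F n).
Proof.
apply: (measurable_fun_fubini_tonelli_G (m1 := mu)
  (fun vo => ((sample_mean H n vo.2 vo.1 - pop_mean H vo.1) ^+ 2)%:E)).
  exact: measurable_sqr_EFin.
by move=> vo; rewrite lee_fin sqr_ge0.
Qed.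

(** Tonelli exchanges the integrals over [omega] and [v]. For fixed [v] the inner integral is the
    variance of an average of indicators, at most [n^-1], and [mu] has total mass 1. *)
Lemma l2_error_mean_le (n : nat) : (0 < n)%N ->
  (\int[P]_omega F n omega <= (n%:R^-1)%:E)%E.
Proof.
move=> n0.
rewrite /F /l2sq -(fubini_tonelli (m1 := mu) (m2 := P)
  (fun vo => ((sample_mean H n vo.2 vo.1 - pop_mean H vo.1) ^+ 2)%:E)); last 2 first.
- exact: measurable_sqr_EFin.
- by move=> vo; rewrite lee_fin sqr_ge0.
have -> : (n%:R^-1)%:E = (\int[mu]_v cst (n%:R^-1)%:E v)%E :> \bar R.
  by rewrite integral_cst//= probability_setT mule1.
apply: ge0_le_integral => //.
- by move=> v _; apply: integral_ge0 => omega _; rewrite lee_fin sqr_ge0.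
- apply: (measurable_fun_fubini_tonelli_F (m2 := P)
    (fun vo => ((sample_mean H n vo.2 vo.1 - pop_mean H vo.1) ^+ 2)%:E)).
    exact: measurable_sqr_EFin.
  by move=> vo; rewrite lee_fin sqr_ge0.
move=> v _ /=.
pose B i := [set omega | H (v, W i omega)].
have mB i : measurable (B i) by exact: measurable_slice.
have BE i : B i = W i @^-1` xsection H v.
  by apply/seteqP; split => omega; rewrite /B /xsection /= inE.
have mHv : measurable (xsection H v) by exact: measurable_xsection.
have PB i : P (B i) = (pop_mean H v)%:E.
  rewrite /pop_mean fineK; last by rewrite fin_num_measure//; exact: mB.
  by rewrite -/(B 0%N) !BE; exact: identW.
have PBB i j : i != j -> P (B i `&` B j) = (pop_mean H v ^+ 2)%:E.
  move=> ij; rewrite !BE pairwise_independent// -!BE !PB.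
  by rewrite -EFinM expr2.
apply: (le_trans _ (variance_indic_average n0 mB PB PBB)).
rewrite le_eqVlt; apply/orP; left; apply/eqP; apply: eq_integral => omega _.
congr ((_ - _) ^+ 2)%:E; congr (_ * _); exact: eq_bigr.
Qed.

(** The sample means at [N] and [n] differ by at most [(n - N) / N], uniformly in [v]; the factor 2
    comes from squaring a sum of two terms. *)
Lemma l2_error_le (N n : nat) (omega : Omega) : (0 < N <= n)%N ->
  (F n omega <= 2%:E * (F N omega + (((n - N)%:R / N%:R) ^+ 2)%:E))%E.
Proof.
move=> Nn.
have mf p : measurable_fun setT (fun v => sample_mean H p omega v - pop_mean H v).
  by apply: measurable_funB; [exact: measurable_sample_mean|exact: measurable_pop_mean].
pose h (b : bool) : T2 -> R :=
  if b then fun v => sample_mean H N omega v - pop_mean H v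
  else cst ((n - N)%:R / N%:R).
have mh b : measurable_fun setT (h b).
  by case: b => /=; [exact: mf|exact: measurable_cst].
suff hae : {ae mu, forall v, `|sample_mean H n omega v - pop_mean H v|
    <= \sum_(b <- [:: true; false]) `|h b v|}.
  have := l2sq_le_sum (mf n) mh hae.
  by rewrite !big_cons !big_nil /= l2sq_cst adde0.
apply: aeW => v; rewrite !big_cons !big_nil /= addr0.
have b01 i : 0 <= (\1_H (v, W i omega) : R) <= 1.
  by rewrite indicE; case: (_ \in _); rewrite /= ?lexx ler01.
have := @average_diff_le R (fun i => \1_H (v, W i omega)) N n b01 Nn.
rewrite -/(sample_mean H n omega v) -/(sample_mean H N omega v).
move=> /le_trans/(_ (ler_norm _)) h1.
set a := sample_mean H n omega v in h1 *; set b := sample_mean H N omega v in h1 *.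
rewrite (_ : a - pop_mean H v = (b - pop_mean H v) + (a - b)); last by ring.
by rewrite (le_trans (ler_normD _ _))// lerD2l.
Qed.

(* The expected squared error 1/n is summable along the squares k^2, and between
   two consecutive squares the sample mean moves by at most 2/k. *)
Lemma integrated_slln :
  {ae P, forall omega, forall e : R, 0 < e ->
    \forall n \near \oo, (F n omega < e%:E)%E}.
Proof.
pose G omega := (\sum_(0 <= k <oo) F (k.+1 ^ 2)%N omega)%E.
have F0 n omega : (0 <= F n omega)%E by exact: l2sq_ge0.
have mG : measurable_fun setT G.
  by apply: ge0_emeasurable_sum => // k _; exact: measurable_F.
have G0 omega : (0 <= G omega)%E by exact: nneseries_ge0.
(* Term-by-term integration bounds the mean of [G] by the sum of the inverse squares, hence by 2.
   Thus [G] is almost surely finite and its terms tend to 0. *)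
have GI : (\int[P]_omega G omega < +oo)%E.
  rewrite integral_nneseries//.
  apply: (@le_lt_trans _ _ 2%:E); last exact: ltry.
  apply: lime_le.
    by apply: is_cvg_nneseries => k _ _; exact: integral_ge0.
  apply: nearW => n.
  apply: (@le_trans _ _ (\sum_(0 <= k < n) ((k.+1 ^ 2)%:R^-1)%:E)%E).
    apply: lee_sum => k _; apply: l2_error_mean_le.
    by rewrite expn_gt0.
  by rewrite sumEFin lee_fin sum_inv_sqr_le2.
have iG : P.-integrable setT G.
  apply/integrableP; split => //.
  by under eq_integral do rewrite gee0_abs//.
apply: filterS (integrable_ae measurableT iG) => omega /(_ I) Gfin e e0.
have Goo : (G omega < +oo)%E by rewrite ltey_eq Gfin.
have e4 : 0 < e / 4 by rewrite divr_gt0.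
have := nneseries_cvg0_near (fun k => F0 _ omega) Goo e4.
move=> [K1 _ hK1].
(* Between [k ^ 2] and its successor square the mean moves by at most [2 / k]. For [k > 16 / e] and
   [k >= 1], the square [4 / k ^+ 2] is below [e / 4], so the total stays below
   [2 * (e / 4 + e / 4) = e]. *)
have [K2 hK2] : exists K2 : nat, 16 / e < K2%:R.
  by exists (Num.truncn (16 / e)).+1; rewrite truncnS_gt.
pose K := maxn K1.+1 K2.+1.
exists (K ^ 2)%N => // n /= Kn.
have [k Kk /andP[kn nk]] := between_squares Kn.
have k0 : (0 < k)%N by rewrite (leq_trans _ Kk)// leq_max.
have kn0 : (0 < k ^ 2 <= n)%N by rewrite expn_gt0 k0.
apply: (le_lt_trans (l2_error_le omega kn0)).
have hk : (F (k ^ 2)%N omega < (e / 4)%:E)%E.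
  (* The series [G] starts at the square of 1, so the term for [k ^ 2] has index [k.-1]; this is why
     [K] is at least [K1.+1]. *)
  have := hK1 k.-1; rewrite /= prednK//; apply.
  by rewrite -ltnS prednK// (leq_trans _ Kk)// leq_max leqnn.
apply: (@lt_le_trans _ _ (2%:E * ((e / 4)%:E + (e / 4)%:E))%E).
  rewrite lte_pmul2l//; apply: lte_leD => //.
  rewrite lee_fin.
  have kR : 0 < k%:R :> R by rewrite ltr0n.
  have h1 : (n - k ^ 2)%:R <= 2 * k%:R :> R.
    rewrite -natrM ler_nat leq_subLR -ltnS (leq_trans nk)//.
    by rewrite -!mulnn; nia.
  have h2 : (n - k ^ 2)%:R / (k ^ 2)%:R <= 2 / k%:R :> R.
    rewrite natrX ler_pdivrMr ?exprn_gt0// (le_trans h1)//.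
    by rewrite le_eqVlt; apply/orP; left; apply/eqP; field; rewrite gt_eqF.
  rewrite (le_trans (lerXn2r 2 _ _ h2))// ?nnegrE ?divr_ge0//.
  have hk2 : 16 / e < k%:R.
    rewrite (lt_le_trans hK2)// ler_nat (leq_trans _ Kk)// leq_max.
    by rewrite leqnSn orbT.
  have k1 : 1 <= k%:R :> R by rewrite ler1n.
  rewrite ltr_pdivrMr// in hk2.
  rewrite expr_div_n ler_pdivrMr ?exprn_gt0//.
  nra.
by rewrite -EFinD -EFinM lee_fin; lra.
Qed.

End integrated_slln.

(** * Supports and conditional densities *)

Section support_full_measure.
Context (R : realType).

(** Separability with an explicit countable family, phrased with balls so that it passes to products
    coordinatewise. *)
Definition metrically_dense (E : pseudoMetricType R) (I : countType) (q : I -> E) :=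
  forall (x : E) (e : R), 0 < e -> exists i, ball (q i) e x.

Lemma metrically_dense_real : metrically_dense (@ratr R : rat -> R).
Proof.
move=> x e e0.
have [|r] := @rat_in_itvoo R (x - e) (x + e); first by lra.
rewrite in_itv /= => /andP[r1 r2]; exists r.
by rewrite /ball /= ltr_norml; apply/andP; split; lra.
Qed.

Lemma metrically_dense_row (k : nat) :
  metrically_dense (map_mx (@ratr R) : 'rV[rat]_k -> 'rV[R]_k).
Proof.
move=> x e e0.
have /choice[r hr] : forall j, exists r : rat, ball (ratr r : R) e (x ord0 j).
  by move=> j; exact: metrically_dense_real.
by exists (\row_j r j); split=> // i j; rewrite !mxE ord1; exact: hr.
Qed.

Lemma metrically_dense_prod (E F : pseudoMetricType R) (I J : countType)
    (q : I -> E) (r : J -> F) : metrically_dense q -> metrically_dense r ->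
  metrically_dense (fun ij : I * J => (q ij.1, r ij.2)).
Proof.
move=> hq hr [x y] e e0; have [i qi] := hq x e e0; have [j rj] := hr y e e0.
by exists (i, j); split.
Qed.

Context (d : measure_display) (T : measurableType d)
  (m : {measure set T -> \bar R}) (E : pseudoMetricType R) (I : countType)
  (q : I -> E) (f : T -> E).
Hypothesis dense_q : metrically_dense q.
Hypothesis mball : forall i e, 0 < e -> measurable (f @^-1` ball (q i) e).

(** A countable base: the balls of radius [n.+1%:R^-1] about the dense points, enumerated by the
    codes of pairs. Numbers that code no pair give the empty set. *)
Let B (j : nat) : set E :=
  if (unpickle j : option (I * nat)%type) is Some ij
  then ball (q ij.1) ij.2.+1%:R^-1 else set0.

Let mB (j : nat) : measurable (f @^-1` B j).
Proof.
rewrite /B; case: unpickle => [ij|]; last by rewrite preimage_set0.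
by apply: mball; rewrite invr_gt0.
Qed.

Let small_ball (O : set E) (x : E) : open O -> O x ->
  exists2 j, B j x & B j `<=` O.
Proof.
move=> oO Ox; have /nbhs_ballP[e /= e0 eO] : nbhs x O by exact: open_nbhs_nbhs.
(* This makes the radius at most [e / 2], so a base ball that contains [x] lies inside the ball of
   radius [e] about [x]. *)
have [n hn] : exists n : nat, 2 / e < n.+1%:R.
  exists (Num.truncn (2 / e)).+1.
  by rewrite (lt_trans (truncnS_gt (2 / e)))// ltr_nat.
have n0 : 0 < n.+1%:R^-1 :> R by rewrite invr_gt0.
have [i qi] := dense_q x n0.
exists (pickle (i, n)); rewrite /B pickleK//= => y qy; apply: eO.
have := ball_triangle (ball_sym qi) qy; apply: le_ball.
have n1 : 0 < n.+1%:R :> R by rewrite ltr0n.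
suff h : n.+1%:R^-1 <= e / 2 by rewrite (splitr e) lerD.
rewrite -[leRHS]invrK lef_pV2 ?posrE ?invr_gt0 ?divr_gt0//.
by rewrite invf_div ltW.
Qed.

Lemma measurable_open_preimage (O : set E) : open O -> measurable (f @^-1` O).
Proof.
move=> oO.
have -> : f @^-1` O = \bigcup_(j in [set j | B j `<=` O]) (f @^-1` B j).
  apply/seteqP; split => [x Ox|x [j /= jO Bx]]; last exact: jO.
  by have [j Bx jO] := small_ball oO Ox; exists j.
by apply: bigcup_measurable => j _; exact: mB.
Qed.

(** A point outside the support has a null open neighbourhood, hence lies in a null base ball. There
    are countably many base balls, so the null ones have a null union. *)
Lemma ae_support : {ae m, forall x, support (fun A => m (f @^-1` A)) (f x)}.
Proof.
pose N j := if m (f @^-1` B j) == 0%E then f @^-1` B j else set0.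
apply: (@negligibleS _ _ _ _ (\bigcup_j N j)); last first.
  apply: negligible_bigcup => j; rewrite /N; case: ifPn => [/eqP mj|_].
    by apply/negligibleP => //; exact: mB.
  exact: negligible_set0.
move=> x /= nsx; apply: contrapT => nN; apply: nsx => O oO Ox.
have [j Bx jO] := small_ball oO Ox.
have mj : m (f @^-1` B j) != 0%E.
  by apply/negP => mj; apply: nN; exists j => //; rewrite /N mj.
apply: (@lt_le_trans _ _ (m (f @^-1` B j))); first by rewrite lt0e mj measure_ge0.
apply: le_measure; rewrite ?inE; [exact: mB|exact: measurable_open_preimage|].
by move=> y; exact: jO.
Qed.

End support_full_measure.

Lemma measurable_row_ball (R : realType) (k : nat) (x : 'rV[R]_k) (e : R) :
  measurable (ball x e : set 'rV[R]_k).
Proof. by apply: sub_sigma_algebra; exact: ball_open. Qed.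

(** * Disintegration along a regular conditional distribution *)

Section conditional_distribution.
Context (R : realType) (d d1 d2 : measure_display) (Omega : measurableType d)
  (T1 : measurableType d1) (T2 : measurableType d2) (P : probability Omega R)
  (X : Omega -> T1) (Z : Omega -> T2) (kappa : R.-pker T1 ~> T2).
Hypotheses (mX : measurable_fun setT X) (mZ : measurable_fun setT Z)
  (hkappa : is_cond_distribution P X Z kappa).

Let kX (C : set (T1 * T2)) omega : \bar R := kappa (X omega) (xsection C (X omega)).

Let measurable_kX C : measurable C -> measurable_fun setT (kX C).
Proof.
move=> mC; apply: (measurableT_comp (f := fun x => kappa x (xsection C x))) => //.
by apply: measurable_fun_xsection_finite_kernel; rewrite inE.
Qed.

(** The defining identity of the kernel is the case of rectangles. Rectangles form a pi-system
    generating the product sigma-algebra, and Dynkin's theorem extends the identity to all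
    measurable sets. *)
Lemma cond_distribution_xsection (C : set (T1 * T2)) : measurable C ->
  P [set omega | C (X omega, Z omega)] =
  (\int[P]_omega kappa (X omega) (xsection C (X omega)))%E.
Proof.
pose G := [set A `*` B | A in @measurable _ T1 & B in @measurable _ T2].
have mXZ C' : measurable C' -> measurable [set omega | C' (X omega, Z omega)].
  move=> mC; rewrite -[Y in measurable Y]setTI.
  have := measurable_fun_pair mX mZ; exact.
have mGE : @measurable _ (T1 * T2)%type = <<s G >>.
  by rewrite measurable_prod_measurableType.
have GP A B : measurable A -> measurable B ->
    P [set omega | (A `*` B) (X omega, Z omega)] = (\int[P]_omega kX (A `*` B) omega)%E.
  move=> mA mB; rewrite -[LHS]/(P (X @^-1` A `&` Z @^-1` B)) hkappa//.
  rewrite integral_mkcond; apply: eq_integral => omega _.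
  rewrite patchE /kX; case: ifPn; rewrite ?inE ?notin_setE /= => XA.
    by rewrite in_xsectionX ?inE.
  by rewrite notin_xsectionX ?measure0 ?notin_setE.
have GT : P [set: Omega] = (\int[P]_omega kX setT omega)%E.
  by have := GP setT setT measurableT measurableT; rewrite setXTT.
suff h : forall S, <<s G >> S ->
    P [set omega | S (X omega, Z omega)] = (\int[P]_omega kX S omega)%E.
  by move=> mC; apply: h; rewrite -mGE.
apply: dynkin_induction => //.
- move=> _ _ [A1 mA1 [B1 mB1 <-]] [A2 mA2 [B2 mB2 <-]].
  exists (A1 `&` A2); first exact: measurableI.
  by exists (B1 `&` B2); [exact: measurableI|rewrite setXI].
- by move=> _ [A mA [B mB <-]]; exact: GP.
(* For complements, the finite number [P S] is added to both sides, which reduces the claim to the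
   total masses compared in [GT]. *)
- move=> S mS PS; have mS' : measurable (~` S) by exact: measurableC.
  have fS : P [set omega | S (X omega, Z omega)] \is a fin_num.
    by rewrite fin_num_measure//; exact: mXZ.
  rewrite -[LHS](addeK _ fS) -[RHS](addeK _ fS); congr (_ - _)%E.
  rewrite [in RHS]PS -ge0_integralD//; last 2 first.
  + exact: measurable_kX.
  + exact: measurable_kX.
  rewrite -measureU; [|exact: mXZ|exact: mXZ|]; last first.
    by rewrite -subset0 => omega [nS]; exact.
  rewrite (_ : _ `|` _ = setT); last first.
    by rewrite -subTset => omega _; rewrite /= orC; exact: lem.
  apply: (etrans GT); apply: eq_integral => omega _; rewrite /kX -measureU.
  + by rewrite !xsectionE preimage_setC setUC setUv preimage_setT.
  + exact: measurable_xsection.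
  + exact: measurable_xsection.
  + by rewrite !xsectionE -subset0 => z [nS]; exact.
- move=> F mF tF PF.
  have -> : [set omega | (\bigcup_k F k) (X omega, Z omega)] =
      \bigcup_k [set omega | F k (X omega, Z omega)].
    by apply/seteqP; split => omega [k _ ?]; exists k.
  rewrite measure_semi_bigcup//; last 3 first.
  + by move=> k; exact: mXZ.
  + apply/trivIsetP => i j _ _ ij; move/trivIsetP : tF => /(_ i j I I ij).
    by rewrite -!subset0 => tF omega [] ? ?; apply: (tF (X omega, Z omega)).
  + by apply: bigcup_measurable => k _; exact: mXZ.
  transitivity (\int[P]_omega \sum_(0 <= k <oo) kX (F k) omega)%E; last first.
    apply: eq_integral => omega _; rewrite /kX xsection_bigcup.
    rewrite measure_semi_bigcup//.
    + by move=> k; exact: measurable_xsection.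
    + exact: trivIset_xsection.
    + by apply: bigcup_measurable => k _; exact: measurable_xsection.
  rewrite integral_nneseries//; last by move=> k; exact: measurable_kX.
  by apply: eq_eseriesr => k _; exact: PF.
Qed.

End conditional_distribution.

(** Given [X = x], the event is that [Z] lies in a closed interval of length [2 * r x], whose kernel
    mass is at most [2 * M * r x]; it remains to integrate over [X]. *)
Lemma probability_tube_le (R : realType) (d d1 : measure_display)
    (Omega : measurableType d) (T : measurableType d1) (P : probability Omega R)
    (X : Omega -> T) (Z : Omega -> R) (kappa : R.-pker T ~> R)
    (M : R) (phi r : T -> R) :
  measurable_fun setT X -> measurable_fun setT Z ->
  is_cond_distribution P X Z kappa ->
  measurable_fun setT phi -> measurable_fun setT r ->
  0 <= M -> (forall x, 0 <= r x) ->
  {ae P, forall omega, forall a b : R, a <= b ->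
     (kappa (X omega) `[a, b]%classic <= (M * (b - a))%:E)%E} ->
  (P [set omega | (`|Z omega - phi (X omega)| <= r (X omega))%R]
    <= \int[P]_omega (2 * M * r (X omega))%:E)%E.
Proof.
move=> mX mZ hkappa mphi mr M0 r0 kM.
pose C := [set xz : T * R | `|xz.2 - phi xz.1| <= r xz.1].
have mC : measurable C.
  rewrite -[C]setTI; apply: (measurable_fun_le measurableT).
    apply: measurableT_comp => //; apply: measurable_funB => //.
    exact: measurableT_comp.
  exact: measurableT_comp.
rewrite -[leLHS]/(P [set omega | C (X omega, Z omega)]).
rewrite (cond_distribution_xsection mX mZ hkappa mC).
apply: ae_ge0_le_integral => //.
- apply: (measurableT_comp (f := fun x => kappa x (xsection C x))) => //.
  by apply: measurable_fun_xsection_finite_kernel; rewrite inE.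
- by move=> omega _; rewrite lee_fin !mulr_ge0.
- by apply/measurable_EFinP; apply: measurable_funM => //; exact: measurableT_comp.
apply: filterS kM => omega kM _; set x := X omega.
have -> : xsection C x = `[phi x - r x, phi x + r x]%classic.
  apply/seteqP; split => z; rewrite xsectionE /C /= in_itv /= ler_norml.
    by move=> /andP[? ?]; apply/andP; split; lra.
  by move=> /andP[? ?]; apply/andP; split; lra.
apply: le_trans (kM _ _ _) _; first by have := r0 x; lra.
by rewrite lee_fin; lra.
Qed.

(** If [u] is not eventually in a neighbourhood [U] of [x], its trace [F] on the complement of [U]
    is a proper filter. By compactness [F] clusters somewhere in [K]; that point is a cluster point
    of [u], hence [x], although [F] avoids [U]. *)
Lemma compact_cvg_cluster (T : topologicalType) (K : set T) (u : nat -> T) (x : T) :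
  compact K -> (\forall n \near \oo, K (u n)) ->
  (forall y, K y -> cluster (u @ \oo) y -> y = x) -> u n @[n --> \oo] --> x.
Proof.
move=> cK uK ux U Ux; apply: contrapT => nU.
pose F := within (~` U) (u @ \oo).
have FE A : F A <-> \forall n \near \oo, ~ U (u n) -> A (u n) by [].
have FF : ProperFilter F.
  apply: Build_ProperFilter => /FE F0; apply: nU.
  by apply: (filterS _ F0) => n /= nUn; apply: contrapT.
have FK : F K by apply/FE; apply: (filterS _ uK) => n Kn _.
have [y [Ky Fy]] := cK F FF FK.
have yx : y = x.
  apply: ux => // A B uA yB; apply: Fy => //.
  have {}uA : \forall n \near \oo, A (u n) by [].
  by apply/FE; apply: (filterS _ uA) => n An _.
subst y.
have FU : F (~` U) by apply/FE; apply: nearW => n.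
by have [z [nUz Uz]] := Fy _ _ FU Ux.
Qed.

(** * Countable intersections and comparisons of almost sure events *)

Section almost_everywhere_lemmas.
Context (R : realType) (d : measure_display) (T : measurableType d).

Lemma ae_forall_countable (m : {measure set T -> \bar R}) (I : countType)
    (Q : I -> T -> Prop) :
  (forall i, {ae m, forall x, Q i x}) -> {ae m, forall x, forall i, Q i x}.
Proof.
move=> hQ.
have : {ae m, forall x, forall n : nat,
    if (unpickle n : option I) is Some i then Q i x else True}.
  apply: ae_foralln => n; case: unpickle => [i|]; first exact: hQ.
  exact: nearW.
by apply: filterS => x h i; have := h (pickle i); rewrite pickleK.
Qed.

Lemma probability_le_ae (P : probability T R) (A B C : set T) :
  measurable A -> measurable B -> measurable C ->
  {ae P, forall x, A x -> B x \/ C x} ->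
  fine (P A) <= fine (P B) + fine (P C).
Proof.
move=> mA mB mC [N [mN PN sN]].
have mBC : measurable (B `|` C) by exact: measurableU.
have fin D : measurable D -> P D \is a fin_num.
  by move=> mD; rewrite fin_num_measure.
rewrite -lee_fin EFinD !fineK ?fin//.
apply: (@le_trans _ _ (P ((B `|` C) `|` N))).
  apply: le_measure; rewrite ?inE//; first exact: measurableU.
  move=> x Ax; have [Nx|nNx] := pselect (N x); first by right.
  by left; apply: contrapT => nBC; apply: nNx; apply: sN => /= h; apply: nBC; exact: h.
apply: (le_trans (measureU2 _ _ _)) => //.
by rewrite [X in (_ + X)%E]PN adde0 measureU2.
Qed.

End almost_everywhere_lemmas.

(** * Measurability and norms of row vectors *)

Section row_vectors.
Context (R : realType) (k : nat).

Lemma measurable_coord (j : 'I_k) :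
  measurable_fun setT (fun x : 'rV[R]_k => x ord0 j).
Proof.
apply: (measurability _ (RGenOpens.measurableE R)).
move=> _ [_ [a [b ->]] <-]; rewrite setTI; apply: sub_sigma_algebra.
apply: open_comp; last exact: interval_open.
by move=> x _; exact: coord_continuous.
Qed.

Lemma measurable_le_vec (d : measure_display) (T : measurableType d)
    (f h : T -> 'rV[R]_k) :
  measurable_fun setT f -> measurable_fun setT h ->
  measurable [set x | le_vec (f x) (h x)].
Proof.
move=> mf mh.
have -> : [set x | le_vec (f x) (h x)] =
    \bigcap_(j in [set: 'I_k]) [set x | f x ord0 j <= h x ord0 j].
  apply/seteqP; split => x; first by move=> /forallP le_fh j _; exact: le_fh.
  by move=> le_fh; apply/forallP => j; exact: le_fh.
apply: fin_bigcap_measurable; first exact: finite_finset.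
move=> j _; rewrite -[X in measurable X]setTI.
by apply: measurable_fun_le => //; apply: (measurableT_comp (measurable_coord j)).
Qed.

(** Balls of row vectors refer to the largest coordinate. The sum of squares is at most
    [k * e ^+ 2], and the cruder [k ^+ 2 * e ^+ 2] avoids a root of [k]. *)
Lemma euclidean_norm_ball (x y : 'rV[R]_k) (e : R) :
  ball x e y -> euclidean_norm (y - x) <= k%:R * e.
Proof.
move=> [e0 xy]; rewrite /euclidean_norm -[leRHS]ger0_norm ?mulr_ge0 ?(ltW e0)//.
rewrite -sqrtr_sqr; apply: ler_wsqrtr; rewrite exprMn.
apply: (@le_trans _ _ (\sum_(j < k) e ^+ 2)).
  apply: ler_sum => j _; rewrite !mxE -real_normK ?num_real//.
  apply: lerXn2r; rewrite ?nnegrE ?(ltW e0)//; apply: ltW.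
  by have := xy ord0 j; rewrite /ball /= distrC.
rewrite sumr_const card_ord -(mulr_natl (e ^+ 2)) ler_wpM2r ?sqr_ge0//.
by rewrite -natrX ler_nat expnS expn1; case: (k) => // n; rewrite leq_pmulr.
Qed.

End row_vectors.

(** * Translation between the criterion norm and its square *)

Section norm_mu_l2sq.
Context (R : realType) (k : nat)
  (mu : probability (('rV[R]_k * 'rV[R]_k) * R)%type R).

Lemma poweR_norm_mu (f : ('rV[R]_k * 'rV[R]_k) * R -> R) :
  (norm_mu mu f `^ 2)%E = l2sq mu f.
Proof.
rewrite /norm_mu poweR_Lnorm ?pnatr_eq0//; apply: eq_integral => v _.
by rewrite -[X in (_ `^ X)%E]/(2%:R) poweR_EFin powR_mulrn// real_normK// num_real.
Qed.

Lemma norm_mu_eq0 (f : ('rV[R]_k * 'rV[R]_k) * R -> R) :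
  norm_mu mu f = 0%E <-> l2sq mu f = 0%E.
Proof.
rewrite -poweR_norm_mu; split=> [->|]; first by rewrite poweR0r// pnatr_eq0.
by move=> /eqP; rewrite poweR_eq0 ?Lnorm_ge0// => /andP[/eqP].
Qed.

Lemma le_norm_mu (f h : ('rV[R]_k * 'rV[R]_k) * R -> R) :
  (norm_mu mu f <= norm_mu mu h)%E -> (l2sq mu f <= l2sq mu h)%E.
Proof.
move=> fh; rewrite -!poweR_norm_mu; apply: gt0_ler_poweR => //.
- by rewrite in_itv /= Lnorm_ge0 leey.
- by rewrite in_itv /= Lnorm_ge0 leey.
Qed.

End norm_mu_l2sq.

(** * Brackets for the moment functions *)

Section bracketing.
Context (R : realType) (k dt : nat).
Local Notation obs := ((R * R) * ('rV[R]_k * 'rV[R]_k))%type.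
Local Notation point := (('rV[R]_k * 'rV[R]_k) * R)%type.
Implicit Types (t : 'I_2) (w : obs) (v : point) (theta : 'rV[R]_dt).

Lemma period_cases t : t = t1 \/ t = t2.
Proof. by case: t => [[|[|//]] ?]; [left|right]; exact: val_inj. Qed.

Definition outcome t w : R := if t == t1 then w.1.1 else w.1.2.
Definition regressor t w : 'rV[R]_k := if t == t1 then w.2.1 else w.2.2.

Lemma measurable_outcome t : measurable_fun setT (outcome t).
Proof.
rewrite /outcome; case: (t == t1).
  exact: (measurableT_comp measurable_fst measurable_fst).
exact: (measurableT_comp measurable_snd measurable_fst).
Qed.

Lemma measurable_regressor t : measurable_fun setT (regressor t).
Proof.
rewrite /regressor; case: (t == t1).
  exact: (measurableT_comp measurable_fst measurable_snd).
exact: (measurableT_comp measurable_snd measurable_snd).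
Qed.

Variable g : 'I_2 -> 'rV[R]_k -> R -> 'rV[R]_dt -> R.

(** The two indicators of period [t] in the moment function, merged into one set so that the law of
    large numbers for sets applies. *)
Definition below theta t : set (point * obs) := [set vw |
  (outcome t vw.2 <= g t (regressor t vw.2) vw.1.2 theta) &&
  (le_vec vw.2.2.1 vw.1.1.1 && le_vec vw.2.2.2 vw.1.1.2)].

Definition tube (gbar : 'rV[R]_k -> R) theta (delta : R) t : set (point * obs) :=
  [set vw | `|outcome t vw.2 - g t (regressor t vw.2) vw.1.2 theta|
            <= gbar (regressor t vw.2) * delta].

Lemma A_momentE theta v w :
  A_moment g theta v w = \1_(below theta t1) (v, w) - \1_(below theta t2) (v, w).
Proof.
rewrite /A_moment !indicE mulrBl -!natrM !mulnb.
by congr (_%:R - _%:R); congr nat_of_bool; apply/idP/idP; rewrite ?inE// => ?; rewrite inE.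
Qed.

(** Off the tube, the outcome is farther from the threshold at [theta] than the two thresholds are
    from each other, so both lie on the same side of it. *)
Lemma below_bracket (gbar : 'rV[R]_k -> R) theta theta' (delta : R) t v w :
  `|g t (regressor t w) v.2 theta' - g t (regressor t w) v.2 theta|
    <= gbar (regressor t w) * delta ->
  `|\1_(below theta' t) (v, w) - \1_(below theta t) (v, w)|
    <= \1_(tube gbar theta delta t) (v, w) :> R.
Proof.
move=> lip; rewrite !indicE.
have [vw|] := boolP ((v, w) \in tube gbar theta delta t).
  by case: (_ \in _); case: (_ \in _); rewrite ?subrr ?subr0 ?sub0r ?normrN ?normr1 ?normr0.
rewrite notin_setE /tube /= => /negP; rewrite -ltNge => far.
suff -> : ((v, w) \in below theta' t) = ((v, w) \in below theta t).
  by rewrite subrr normr0.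
suff h : (outcome t w <= g t (regressor t w) v.2 theta') =
         (outcome t w <= g t (regressor t w) v.2 theta).
  by apply/idP/idP; rewrite !inE /below /= h.
move: far lip; rewrite lter_normr ler_norml => /orP far /andP[l1 l2].
by apply/idP/idP => le_y; case: far => far; lra.
Qed.

Lemma measurable_model theta t :
  measurable_fun [set: 'rV[R]_k * R] (fun p => g t p.1 p.2 theta) ->
  measurable_fun setT (fun vw : point * obs => g t (regressor t vw.2) vw.1.2 theta).
Proof.
move=> mg; have mp : measurable_fun setT (fun vw : point * obs => (regressor t vw.2, vw.1.2)).
  apply: measurable_fun_pair.
    exact: (measurableT_comp (measurable_regressor t) measurable_snd).
  exact: (measurableT_comp measurable_snd measurable_fst).
exact: (measurableT_comp mg mp).
Qed.

Lemma measurable_below theta t :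
  measurable_fun [set: 'rV[R]_k * R] (fun p => g t p.1 p.2 theta) ->
  measurable (below theta t).
Proof.
move=> mg.
have -> : below theta t =
    [set vw | outcome t vw.2 <= g t (regressor t vw.2) vw.1.2 theta] `&`
    ([set vw | le_vec vw.2.2.1 vw.1.1.1] `&` [set vw | le_vec vw.2.2.2 vw.1.1.2]).
  apply/seteqP; split => vw; first by move=> /andP[? /andP[? ?]].
  by move=> [h1 [h2 h3]]; apply/andP; split => //; apply/andP.
apply: measurableI; last apply: measurableI.
- rewrite -[X in measurable X]setTI; apply: measurable_fun_le => //.
    exact: (measurableT_comp (measurable_outcome t) measurable_snd).
  exact: measurable_model.
- apply: measurable_le_vec.
    exact: (measurableT_comp (measurableT_comp measurable_fst measurable_snd) measurable_snd).
  exact: (measurableT_comp (measurableT_comp measurable_fst measurable_fst) measurable_fst).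
- apply: measurable_le_vec.
    exact: (measurableT_comp (measurableT_comp measurable_snd measurable_snd) measurable_snd).
  exact: (measurableT_comp (measurableT_comp measurable_snd measurable_fst) measurable_fst).
Qed.

Lemma measurable_tube (gbar : 'rV[R]_k -> R) theta (delta : R) t :
  measurable_fun [set: 'rV[R]_k * R] (fun p => g t p.1 p.2 theta) ->
  measurable_fun setT gbar -> measurable (tube gbar theta delta t).
Proof.
move=> mg mgbar.
rewrite -[X in measurable X]setTI; apply: measurable_fun_le => //.
  apply: measurableT_comp => //; apply: measurable_funB; last exact: measurable_model.
  exact: (measurableT_comp (measurable_outcome t) measurable_snd).
apply: measurable_funM => //; apply: (measurableT_comp mgbar).
exact: (measurableT_comp (measurable_regressor t) measurable_snd).
Qed.

End bracketing.

(** * Consistency *)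

Section sample_lemmas.
Context (R : realType) (d d1 d2 : measure_display) (Omega : measurableType d)
  (T1 : measurableType d1) (T2 : measurableType d2)
  (P : probability Omega R) (W : nat -> Omega -> T1).
Hypothesis mW : forall i, measurable_fun setT (W i).

Lemma sample_mean_bracket (A B C : set (T2 * T1)) n omega v :
  (forall i, `|\1_A (v, W i omega) - \1_B (v, W i omega)|
     <= \1_C (v, W i omega) :> R) ->
  `|sample_mean R W A n omega v - sample_mean R W B n omega v|
    <= sample_mean R W C n omega v.
Proof.
move=> ABC; rewrite /sample_mean -mulrBr normrM ger0_norm ?invr_ge0//.
rewrite ler_wpM2l ?invr_ge0// -sumrB (le_trans (ler_norm_sum _ _ _))//.
by apply: ler_sum => i _; exact: ABC.
Qed.

Lemma pop_mean_bracket (A B C : set (T2 * T1)) v :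
  measurable A -> measurable B -> measurable C ->
  {ae P, forall omega, `|\1_A (v, W 0%N omega) - \1_B (v, W 0%N omega)|
     <= \1_C (v, W 0%N omega) :> R} ->
  `|pop_mean P W A v - pop_mean P W B v| <= pop_mean P W C v.
Proof.
move=> mA mB mC ABC.
have mS (D : set (T2 * T1)) : measurable D -> measurable [set omega | D (v, W 0%N omega)].
  exact: measurable_slice.
(* One side of the absolute value; the other follows by exchanging the two sets. *)
have half (A' B' : set (T2 * T1)) : measurable A' -> measurable B' ->
    {ae P, forall omega, `|\1_A' (v, W 0%N omega) - \1_B' (v, W 0%N omega)|
     <= \1_C (v, W 0%N omega) :> R} ->
    pop_mean P W A' v <= pop_mean P W B' v + pop_mean P W C v.
  move=> mA' mB' ABC'.
  apply: probability_le_ae; [exact: mS|exact: mS|exact: mS|].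
  apply: filterS ABC' => omega; rewrite !indicE => h Av.
  have [Bv|Bv] := boolP ((v, W 0%N omega) \in B'); first by left; rewrite inE in Bv.
  have [Cv|Cv] := boolP ((v, W 0%N omega) \in C); first by right; rewrite inE in Cv.
  move: h; rewrite (negbTE Bv) (negbTE Cv) (mem_set (Av : A' (v, W 0%N omega))).
  by rewrite subr0 normr1 ler10.
have h1 := half _ _ mA mB ABC.
have h2 : pop_mean P W B v <= pop_mean P W A v + pop_mean P W C v.
  by apply: half => //; apply: filterS ABC => omega; rewrite distrC.
by rewrite ler_norml; apply/andP; split; lra.
Qed.

End sample_lemmas.

Section consistency.
Context (R : realType) (k dt : nat) (d : measure_display)
  (Omega : measurableType d) (P : probability Omega R)
  (Y : nat -> 'I_2 -> {RV P >-> R}) (X : nat -> 'I_2 -> {RV P >-> 'rV[R]_k})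
  (g : 'I_2 -> 'rV[R]_k -> R -> 'rV[R]_dt -> R)
  (Theta : set 'rV[R]_dt) (SX : 'I_2 -> set 'rV[R]_k) (SU : set R)
  (mu : probability (('rV[R]_k * 'rV[R]_k) * R)%type R)
  (kY : 'I_2 -> R.-pker ('rV[R]_k * 'rV[R]_k)%type ~> R)
  (gbar : 'rV[R]_k -> R) (K M : R).
Local Notation point := (('rV[R]_k * 'rV[R]_k) * R)%type.
Local Notation W := (obsW Y X).
Local Notation B := (2 * M * K).

Hypotheses
  (hkY : forall t, is_cond_distribution P (pairX X 0%N) (Y 0%N t) (kY t))
  (hindep : mutually_independent P W) (hident : identically_distributed P W)
  (hgmeas : forall t theta, Theta theta ->
     measurable_fun [set: 'rV[R]_k * R] (fun p => g t p.1 p.2 theta))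
  (gbar_gt0 : forall x, 0 < gbar x) (mgbar : measurable_fun setT gbar)
  (Egbar : forall t, ('E_P[gbar \o X 0%N t] <= K%:E)%E)
  (lipg : forall t x u theta theta', SX t x -> SU u -> Theta theta ->
     Theta theta' -> `|g t x u theta' - g t x u theta|
       <= gbar x * euclidean_norm (theta' - theta))
  (K0 : 0 <= K) (M0 : 0 <= M)
  (density_le : forall t, {ae P, forall omega, forall a b : R, a <= b ->
     (kY t (pairX X 0%N omega) `[a, b]%classic <= (M * (b - a))%:E)%E})
  (aeX : {ae P, forall omega, forall i t, SX t (X i t omega)})
  (aemu : {ae mu, forall v, SU v.2}).

Lemma outcome_obsW t i omega : outcome t (W i omega) = Y i t omega.
Proof. by case: (period_cases t) => ->. Qed.

Lemma regressor_obsW t i omega : regressor t (W i omega) = X i t omega.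
Proof. by case: (period_cases t) => ->. Qed.

Lemma measurable_pairX i : measurable_fun setT (pairX X i).
Proof. exact: measurable_fun_pair. Qed.

Lemma measurable_obsW i : measurable_fun setT (W i).
Proof.
apply: measurable_fun_pair; last exact: measurable_pairX.
exact: measurable_fun_pair.
Qed.

Let mbelow t theta : Theta theta -> measurable (below g theta t).
Proof. by move=> Th; apply: measurable_below; exact: hgmeas. Qed.

Let mtube t theta (delta : R) : Theta theta -> measurable (tube g gbar theta delta t).
Proof. by move=> Th; apply: measurable_tube => //; exact: hgmeas. Qed.

(** Conditionally on the regressors the tube has mass at most [2 * M * delta * gbar (X 0 t)], and
    [gbar] has mean at most [K]. The bound is free of [v]. *)
Lemma pop_mean_tube_le t theta (delta : R) (v : point) : Theta theta -> 0 <= delta ->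
  pop_mean P W (tube g gbar theta delta t) v <= B * delta.
Proof.
move=> Th delta0.
(* The kernel conditions on the regressors of both periods, so the tube must be written as a
   function of the pair. *)
pose pick (x : 'rV[R]_k * 'rV[R]_k) := if t == t1 then x.1 else x.2.
have mpick : measurable_fun setT pick.
  by rewrite /pick; case: (t == t1); [exact: measurable_fst|exact: measurable_snd].
have pickX omega : pick (pairX X 0%N omega) = X 0%N t omega.
  by rewrite /pick; case: (period_cases t) => ->.
have mS : measurable [set omega | tube g gbar theta delta t (v, W 0%N omega)].
  by apply: measurable_slice; [exact: measurable_obsW|exact: mtube].
rewrite -lee_fin /pop_mean fineK; last by rewrite fin_num_measure.
have -> : [set omega | tube g gbar theta delta t (v, W 0%N omega)] =
    [set omega | `|Y 0%N t omega - g t (pick (pairX X 0%N omega)) v.2 theta|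
      <= gbar (pick (pairX X 0%N omega)) * delta].
  by apply/seteqP; split => omega; rewrite /tube /= outcome_obsW regressor_obsW pickX.
have mgv : measurable_fun setT (fun x => g t (pick x) v.2 theta).
  have mp : measurable_fun setT (fun x => (pick x, v.2)) by exact: measurable_fun_pair.
  exact: (measurableT_comp (hgmeas t Th) mp).
have mgd : measurable_fun setT (fun x => gbar (pick x) * delta).
  by apply: measurable_funM => //; exact: (measurableT_comp mgbar mpick).
have gd0 x : 0 <= gbar (pick x) * delta by rewrite mulr_ge0// ltW.
apply: (le_trans (probability_tube_le (measurable_pairX 0)
  (measurable_funPT (Y 0%N t)) (hkY t) mgv mgd M0 gd0 (density_le t))).
rewrite (eq_integral (fun omega => (2 * M * delta)%:E * (gbar (X 0%N t omega))%:E)%E); last first.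
  by move=> omega _; rewrite pickX -EFinM; congr _%:E; ring.
rewrite ge0_integralZl//; last 3 first.
- by apply/measurable_EFinP; exact: measurableT_comp.
- by move=> omega _; rewrite lee_fin ltW.
- by rewrite lee_fin !mulr_ge0.
have := Egbar t; rewrite unlock => EK.
rewrite (_ : B * delta = (2 * M * delta) * K); last by ring.
by rewrite [leRHS]EFinM; apply: lee_wpmul2l; rewrite ?lee_fin ?mulr_ge0.
Qed.

Lemma D_popE theta : Theta theta -> D_pop P g (W 0%N) theta =
  (fun v => pop_mean P W (below g theta t1) v - pop_mean P W (below g theta t2) v).
Proof.
move=> Th; apply/funext => v.
pose E t := [set omega | below g theta t (v, W 0%N omega)].
have mE t : measurable (E t).
  by apply: measurable_slice; [exact: measurable_obsW|exact: mbelow].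
have LE t : (\1_(E t) : Omega -> R) \in Lfun P 1.
  apply/Lfun1_integrable; apply: (@integrable_bounded_probability _ _ _ _ 1).
    exact: measurable_indic.
  by move=> x; rewrite indicE; case: (_ \in _); rewrite ?normr1 ?normr0.
rewrite /D_pop (_ : (fun omega => _) = (\1_(E t1) : Omega -> R) \- \1_(E t2)); last first.
  apply/funext => omega; rewrite A_momentE !indicE /=.
  by congr (_%:R - _%:R); congr nat_of_bool; apply/idP/idP; rewrite !inE.
by rewrite expectationB// !expectation_indic// fineB// fin_num_measure.
Qed.

Lemma D_hatE n omega theta : D_hat g W n omega theta =
  (fun v => sample_mean R W (below g theta t1) n omega v
            - sample_mean R W (below g theta t2) n omega v).
Proof.
apply/funext => v; rewrite /D_hat /sample_mean -mulrBr -sumrB.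
by congr (_ * _); apply: eq_bigr => i _; rewrite A_momentE.
Qed.

Let err (H : set (point * ((R * R) * ('rV[R]_k * 'rV[R]_k)))) n omega : point -> R :=
  fun v => sample_mean R W H n omega v - pop_mean P W H v.

Let merr H n omega : measurable H -> measurable_fun setT (err H n omega).
Proof.
move=> mH; apply: measurable_funB.
  by apply: measurable_sample_mean => // i; exact: measurable_obsW.
by apply: measurable_pop_mean => // i; exact: measurable_obsW.
Qed.

Let mD_pop theta : Theta theta -> measurable_fun setT (D_pop P g (W 0%N) theta).
Proof.
move=> Th; rewrite D_popE//; apply: measurable_funB.
  by apply: measurable_pop_mean; [exact: measurable_obsW|exact: mbelow].
by apply: measurable_pop_mean; [exact: measurable_obsW|exact: mbelow].
Qed.

Let mD_hat n omega theta : Theta theta -> measurable_fun setT (D_hat g W n omega theta).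
Proof.
move=> Th; rewrite D_hatE; apply: measurable_funB.
  by apply: measurable_sample_mean; [exact: measurable_obsW|exact: mbelow].
by apply: measurable_sample_mean; [exact: measurable_obsW|exact: mbelow].
Qed.

(** The sample moment is the population moment plus the error of period 1 minus that of period 2. At
    [theta0] only the errors remain. *)
Lemma l2sq_D_hat_le n omega theta : Theta theta ->
  (l2sq mu (D_hat g W n omega theta) <=
   3%:E * (l2sq mu (D_pop P g (W 0%N) theta) +
           (l2sq mu (err (below g theta t1) n omega) +
            l2sq mu (err (below g theta t2) n omega))))%E.
Proof.
move=> Th.
pose h := nth (cst 0) [:: D_pop P g (W 0%N) theta;
  err (below g theta t1) n omega; err (below g theta t2) n omega].
have mh i : measurable_fun setT (h i).
  case: i => [|[|[|i]]]; rewrite /h /=.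
  - exact: mD_pop.
  - by apply: merr; exact: mbelow.
  - by apply: merr; exact: mbelow.
  - by rewrite nth_nil.
have hae : {ae mu, forall v, `|D_hat g W n omega theta v|
    <= \sum_(i <- iota 0 3) `|h i v|}.
  apply: aeW => v; rewrite !big_cons !big_nil /h /= addr0 D_hatE D_popE// /err.
  set s1 := sample_mean _ _ _ _ _ _; set s2 := sample_mean _ _ _ _ _ _.
  set p1 := pop_mean _ _ _ _; set p2 := pop_mean _ _ _ _.
  rewrite (_ : s1 - s2 = (p1 - p2) + ((s1 - p1) - (s2 - p2))); last by ring.
  by rewrite (le_trans (ler_normD _ _))// lerD2l ler_normB.
have := l2sq_le_sum (mD_hat n omega Th) mh hae.
by rewrite !big_cons !big_nil /= adde0.
Qed.

(** The path goes from the population moment at [theta] to that at [c], then to the sample moment at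
    [c], then to that at [theta']. The first leg costs [B * delta] per period and the second the
    errors of [below]. The third costs a sample tube per period, that is, its error plus another
    [B * delta]. This gives six terms, the constant being [4 * B * delta]. *)
Lemma l2sq_D_pop_le n omega theta c theta' (delta : R) :
  Theta theta -> Theta c -> Theta theta' -> 0 <= delta ->
  euclidean_norm (theta - c) <= delta -> euclidean_norm (theta' - c) <= delta ->
  (forall i t, SX t (X i t omega)) ->
  (l2sq mu (D_pop P g (W 0%N) theta) <=
   6%:E * (((4 * B * delta) ^+ 2)%:E +
     (l2sq mu (err (below g c t1) n omega) +
     (l2sq mu (err (below g c t2) n omega) +
     (l2sq mu (err (tube g gbar c delta t1) n omega) +
     (l2sq mu (err (tube g gbar c delta t2) n omega) +
      l2sq mu (D_hat g W n omega theta')))))))%E.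
Proof.
move=> Th Tc Th' delta0 thc th'c Xomega.
pose h := nth (cst 0) [:: cst (4 * B * delta);
  err (below g c t1) n omega; err (below g c t2) n omega;
  err (tube g gbar c delta t1) n omega; err (tube g gbar c delta t2) n omega;
  D_hat g W n omega theta'].
have mh i : measurable_fun setT (h i).
  case: i => [|[|[|[|[|[|i]]]]]]; rewrite /h /=.
  - exact: measurable_cst.
  - by apply: merr; exact: mbelow.
  - by apply: merr; exact: mbelow.
  - by apply: merr; exact: mtube.
  - by apply: merr; exact: mtube.
  - exact: mD_hat.
  - by rewrite nth_nil.
have hae : {ae mu, forall v, `|D_pop P g (W 0%N) theta v|
    <= \sum_(i <- iota 0 6) `|h i v|}.
  apply: filterS aemu => v Uv.
  rewrite !big_cons !big_nil /h /= addr0 D_hatE D_popE// /err.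
  (* The outcome [omega'] is left free because the bracket serves both the sample at [omega] and,
     almost surely, the population mean. *)
  have lip t i theta'' omega' : Theta theta'' -> euclidean_norm (theta'' - c) <= delta ->
      (forall i t, SX t (X i t omega')) ->
      `|\1_(below g theta'' t) (v, W i omega') - \1_(below g c t) (v, W i omega')|
        <= \1_(tube g gbar c delta t) (v, W i omega') :> R.
    move=> Th'' th''c Xomega'; apply: below_bracket; rewrite regressor_obsW.
    by rewrite (le_trans (lipg _ _ _ _))// ler_wpM2l// ltW.
  have pop t : `|pop_mean P W (below g theta t) v - pop_mean P W (below g c t) v|
      <= B * delta.
    rewrite (le_trans _ (pop_mean_tube_le t v Tc delta0))//.
    apply: pop_mean_bracket; [exact: measurable_obsW|exact: mbelow|exact: mbelow|exact: mtube|].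
    by apply: filterS aeX => omega' Xomega'; exact: lip.
  have smp t : `|sample_mean R W (below g theta' t) n omega v
      - sample_mean R W (below g c t) n omega v|
      <= sample_mean R W (tube g gbar c delta t) n omega v.
    by apply: sample_mean_bracket => i; exact: lip.
  have popt t := pop_mean_tube_le t v Tc delta0.
  have err_le (a b : R) : a <= `|a - b| + b by rewrite -lerBlDr ler_norm.
  move: (pop t1) (pop t2) (smp t1) (smp t2) (popt t1) (popt t2).
  have bd0 : 0 <= 4 * B * delta by rewrite !mulr_ge0.
  rewrite (ger0_norm bd0).
  set p1 := pop_mean _ _ (below g theta t1) _; set p2 := pop_mean _ _ (below g theta t2) _.
  set q1 := pop_mean _ _ (below g c t1) _; set q2 := pop_mean _ _ (below g c t2) _.
  set r1 := sample_mean _ _ (below g c t1) _ _ _; set r2 := sample_mean _ _ (below g c t2) _ _ _.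
  set s1 := sample_mean _ _ (below g theta' t1) _ _ _.
  set s2 := sample_mean _ _ (below g theta' t2) _ _ _.
  set u1 := sample_mean _ _ (tube _ _ _ _ t1) _ _ _; set u2 := sample_mean _ _ (tube _ _ _ _ t2) _ _ _.
  set w1 := pop_mean _ _ (tube _ _ _ _ t1) _; set w2 := pop_mean _ _ (tube _ _ _ _ t2) _.
  have := err_le u1 w1; have := err_le u2 w2.
  rewrite (_ : p1 - p2 = (p1 - q1) - (p2 - q2) - (r1 - q1) + (r2 - q2)
     - (s1 - r1) + (s2 - r2) + (s1 - s2)); last by ring.
  have n7 (a1 a2 a3 a4 a5 a6 a7 : R) : `|a1 - a2 - a3 + a4 - a5 + a6 + a7|
      <= `|a1| + `|a2| + `|a3| + `|a4| + `|a5| + `|a6| + `|a7|.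
    rewrite (le_trans (ler_normD _ _))// lerD2r (le_trans (ler_normD _ _))// lerD2r.
    rewrite (le_trans (ler_normB _ _))// lerD2r (le_trans (ler_normD _ _))// lerD2r.
    by rewrite (le_trans (ler_normB _ _))// lerD2r ler_normB.
  move=> *; apply: (le_trans (n7 _ _ _ _ _ _ _)).
  by rewrite (_ : 4 * B * delta = B * delta + B * delta + B * delta + B * delta); [lra|ring].
have := l2sq_le_sum (mD_pop Th) mh hae.
by rewrite !big_cons !big_nil /= adde0 l2sq_cst.
Qed.

Lemma ae_l2sq_err_small (I : countType) (H : I -> set (point * ((R * R) * ('rV[R]_k * 'rV[R]_k)))) :
  (forall i, measurable (H i)) ->
  {ae P, forall omega, forall i (e : R), 0 < e ->
     \forall n \near \oo, (l2sq mu (err (H i) n omega) < e%:E)%E}.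
Proof.
move=> mH; apply: ae_forall_countable => i.
exact: (integrated_slln mu measurable_obsW hindep hident (mH i)).
Qed.

(** Rational points may lie outside [Theta], so each rational ball that meets [Theta] is represented
    by one of its points in [Theta], which doubles the radius. Balls missing [Theta] get the default
    [theta0]. *)
Lemma parameter_net : Theta !=set0 -> exists c : 'rV[rat]_dt * nat -> 'rV[R]_dt,
  (forall j, Theta (c j)) /\
  forall theta m, Theta theta -> exists i, ball (c (i, m)) (2 / m.+1%:R) theta.
Proof.
move=> [theta0 Th0].
pose q : 'rV[rat]_dt -> 'rV[R]_dt := map_mx (@ratr R).
have /choice[c hc] : forall j : 'rV[rat]_dt * nat, exists th, Theta th /\
    forall y, Theta y -> ball (q j.1) j.2.+1%:R^-1 y -> ball (q j.1) j.2.+1%:R^-1 th.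
  move=> j; have [[y [Ty qy]]|no] := pselect (exists y,
    Theta y /\ ball (q j.1) j.2.+1%:R^-1 y); first by exists y.
  by exists theta0; split => // y Ty qy; case: no; exists y.
exists c; split => [j|theta m Th]; first by case: (hc j).
have m0 : 0 < m.+1%:R^-1 :> R by rewrite invr_gt0.
have [i qi] := metrically_dense_row theta m0.
exists i; have [_ /(_ theta Th qi) ci] := hc (i, m).
have := ball_triangle (ball_sym ci) qi.
by rewrite (_ : m.+1%:R^-1 + m.+1%:R^-1 = 2 / m.+1%:R) // mulr_natl mulr2n.
Qed.

(** By compactness it suffices that every cluster point [y] has a vanishing population criterion.
    This is shown up to any [eta], at one sample size where the estimator is near [y] and all errors
    are small. *)
Lemma extremum_consistent (theta0 : 'rV[R]_dt) (thetahat : nat -> Omega -> 'rV[R]_dt) :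
  compact Theta -> Theta theta0 ->
  (forall theta, Theta theta ->
    l2sq mu (D_pop P g (W 0%N) theta) = 0%E <-> theta = theta0) ->
  (forall n omega, (0 < n)%N -> Theta (thetahat n omega) /\
    (l2sq mu (D_hat g W n omega (thetahat n omega)) <=
     l2sq mu (D_hat g W n omega theta0))%E) ->
  {ae P, forall omega, thetahat n omega @[n --> \oo] --> theta0}.
Proof.
move=> cTheta Th0 ident hmin.
have [c [Tc cnet]] := parameter_net (ex_intro _ _ Th0).
(* Of the 3, two parts are the radius of the net and one is the distance from [y] to the estimator;
   [dt] converts coordinatewise balls to the Euclidean norm. *)
pose delta (m : nat) : R := dt%:R * (3 / m.+1%:R).
have delta0 m : 0 <= delta m by rewrite mulr_ge0 ?divr_ge0.
have aec := ae_l2sq_err_small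
  (fun jt : ('rV[rat]_dt * nat) * 'I_2 => mbelow jt.2 (Tc jt.1)).
have aet := ae_l2sq_err_small
  (fun jt : ('rV[rat]_dt * nat) * 'I_2 => mtube jt.2 (delta jt.1.2) (Tc jt.1)).
have ae0 := ae_l2sq_err_small (fun t : 'I_2 => mbelow t Th0).
have D0 : l2sq mu (D_pop P g (W 0%N) theta0) = 0%E by apply/ident.
apply: (filterS _ (filterI (filterI aeX aec) (filterI aet ae0))) => omega.
move=> [[Xomega small_c] [small_t small_0]].
apply: (compact_cvg_cluster cTheta).
  by exists 1%N => // n /= n0; have [] := hmin n omega n0.
move=> y Ty cly; apply/ident => //.
apply/eqP; rewrite eq_le l2sq_ge0 andbT; apply/lee_addgt0Pr => eta eta0.
rewrite add0e.
(* Then [4 * B * delta m = a / m.+1%:R], and the choice of [m] below makes six times its square at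
   most [eta / 2]. *)
pose a := 12 * B * dt%:R.
have [m hm] : exists m : nat, 12 * a ^+ 2 / eta < m.+1%:R.
  exists (Num.truncn (12 * a ^+ 2 / eta)).+1.
  by rewrite (lt_trans (truncnS_gt _))// ltr_nat.
have [i ciy] := cnet y m Ty.
(* The errors at [theta0] bound the sample criterion by [3 * (2 * eta / 120) = eta / 20]. With the
   four errors at the net point this gives [6 * (4 * eta / 120 + eta / 20) = eta / 2]. *)
have e0 : 0 < eta / 120 by rewrite divr_gt0.
have m0 : 0 < m.+1%:R^-1 :> R by rewrite invr_gt0.
(* A cluster point only sees sets of parameters, so the sample size is carried as a witness inside
   [A] and recovered where [A] meets the ball about [y]. *)
pose A := [set z | exists n, [/\ z = thetahat n omega, (0 < n)%N &
  [/\ (l2sq mu (err (below g theta0 t1) n omega) < (eta / 120)%:E)%E,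
      (l2sq mu (err (below g theta0 t2) n omega) < (eta / 120)%:E)%E &
  [/\ (l2sq mu (err (below g (c (i, m)) t1) n omega) < (eta / 120)%:E)%E,
      (l2sq mu (err (below g (c (i, m)) t2) n omega) < (eta / 120)%:E)%E,
      (l2sq mu (err (tube g gbar (c (i, m)) (delta m) t1) n omega)
         < (eta / 120)%:E)%E &
      (l2sq mu (err (tube g gbar (c (i, m)) (delta m) t2) n omega)
         < (eta / 120)%:E)%E]]]].
have q1 := small_0 t1 _ e0; have q2 := small_0 t2 _ e0.
have q3 := small_c ((i, m), t1) _ e0; have q4 := small_c ((i, m), t2) _ e0.
have q5 := small_t ((i, m), t1) _ e0; have q6 := small_t ((i, m), t2) _ e0.
have FA : \forall n \near \oo, A (thetahat n omega).
  have n1 : \forall n \near \oo, (0 < n)%N by exact: nbhs_infty_gt.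
  have both (Q1 Q2 : nat -> Prop) : (\forall n \near \oo, Q1 n) ->
      (\forall n \near \oo, Q2 n) -> \forall n \near \oo, Q1 n /\ Q2 n.
    by move=> ? ?; near=> n; split; near: n.
  have [N _ hN] := both _ _ n1 (both _ _ (both _ _ q1 q2)
    (both _ _ (both _ _ q3 q4) (both _ _ q5 q6))).
  exists N => // n /= /hN [n0 [[? ?] [[? ?] [? ?]]]].
  by exists n.
have By : nbhs y (ball y m.+1%:R^-1) by exact: nbhsx_ballx.
have [_ [[n [-> n0 [p1 p2 [p3 p4 p5 p6]]]] yn]] := cly _ _ FA By.
have [Tn hn] := hmin n omega n0.
have b3 : 2 / m.+1%:R + m.+1%:R^-1 = 3 / m.+1%:R :> R by rewrite -[X in _ + X]mul1r -mulrDl natr1.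
have ydelta : euclidean_norm (y - c (i, m)) <= delta m.
  apply: euclidean_norm_ball; apply: le_ball ciy.
  by rewrite -b3 lerDl ltW.
have ndelta : euclidean_norm (thetahat n omega - c (i, m)) <= delta m.
  by apply: euclidean_norm_ball; rewrite -b3; exact: ball_triangle ciy yn.
apply: (le_trans (l2sq_D_pop_le n Ty (Tc _) Tn (delta0 m) ydelta ndelta Xomega)).
have hD : (l2sq mu (D_hat g W n omega (thetahat n omega)) <= (eta / 20)%:E)%E.
  apply: (le_trans hn); apply: (le_trans (l2sq_D_hat_le n omega Th0)).
  rewrite D0 add0e.
  apply: (@le_trans _ _ (3%:E * ((eta / 120)%:E + (eta / 120)%:E))%E).
    by rewrite lee_pmul2l//; apply: leeD; exact: ltW.
  by rewrite -EFinD -EFinM lee_fin; lra.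
have hdelta : 6 * (4 * B * delta m) ^+ 2 <= eta / 2.
  rewrite (_ : 4 * B * delta m = a / m.+1%:R); last by rewrite /delta /a; set x := _^-1; ring.
  have m1 : 1 <= m.+1%:R :> R by rewrite ler1n.
  move: hm; rewrite ltr_pdivrMr// => hm.
  rewrite expr_div_n mulrA ler_pdivrMr ?exprn_gt0//.
  nra.
apply: (@le_trans _ _ (6%:E * (((4 * B * delta m) ^+ 2)%:E + ((eta / 120)%:E +
  ((eta / 120)%:E + ((eta / 120)%:E + ((eta / 120)%:E + (eta / 20)%:E))))))%E).
  rewrite lee_pmul2l//; do 4 (apply: leeD; first by rewrite ?lexx ?ltW).
  by apply: leeD => //; exact: ltW.
by rewrite -!EFinD -EFinM lee_fin; lra.
Unshelve. all: by end_near. Qed.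

End consistency.

(** * Reduction of the theorem to [extremum_consistent] *)

Theorem theorem2 (R : realType) (k dt : nat)
  (d : measure_display) (Omega : measurableType d) (P : probability Omega R)
  (Y : nat -> 'I_2 -> {RV P >-> R})
  (X : nat -> 'I_2 -> {RV P >-> 'rV[R]_k})
  (U : nat -> 'I_2 -> {RV P >-> R})
  (g : 'I_2 -> 'rV[R]_k -> R -> 'rV[R]_dt -> R)
  (Theta : set 'rV[R]_dt) (theta0 : 'rV[R]_dt)
  (thetahat : nat -> Omega -> 'rV[R]_dt)
  (* supports *)
  (SX : 'I_2 -> set 'rV[R]_k) (SX12 : set ('rV[R]_k * 'rV[R]_k)) (SU : set R)
  (hSX : forall t, SX t = support (distribution P (X 0%N t)))
  (hSX12 : SX12 = support (pushforward P (pairX X 0%N)))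
  (hSU : forall i t, support (distribution P (U i t)) = SU)
  (* the weighting measure *)
  (mu : probability (('rV[R]_k * 'rV[R]_k) * R)%type R)
  (hmu : support mu = SX12 `*` SU)
  (* conditional distributions of U_it and Y_it given (X_i1, X_i2) *)
  (kU kY : 'I_2 -> R.-pker ('rV[R]_k * 'rV[R]_k)%type ~> R)
  (hkU : forall i t, is_cond_distribution P (pairX X i) (U i t) (kU t))
  (hkY : forall i t, is_cond_distribution P (pairX X i) (Y i t) (kY t))
  (* i.i.d. observations from the parametric model *)
  (hindep : mutually_independent P (obsW Y X))
  (hident : identically_distributed P (obsW Y X))
  (htheta0 : Theta theta0)
  (hmodel : forall i t,
     {ae P, forall omega, Y i t omega = g t (X i t omega) (U i t omega) theta0})
  (hgmeas : forall t theta, Theta theta ->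
     measurable_fun [set: 'rV[R]_k * R] (fun p => g t p.1 p.2 theta))
  (* (P1) *)
  (P1g : forall t theta x, Theta theta -> SX t x ->
     {within SU, continuous (fun u => g t x u theta)} /\
     (forall u u', SU u -> SU u' -> u < u' -> g t x u theta < g t x u' theta))
  (P1U : forall t x, SX12 x -> continuous (dist_fun (kU t x)))
  (* (P2) *)
  (P2 : forall t x, SX12 x ->
     continuous (dist_fun (kY t x)) /\
     (forall y y', support (kY t x) y -> support (kY t x) y' -> y < y' ->
        dist_fun (kY t x) y < dist_fun (kY t x) y'))
  (* (P3) *)
  (P3norm : exists2 xbar, SX t1 xbar &
     forall u theta, SU u -> Theta theta -> g t1 xbar u theta = u)
  (P3sep : forall theta theta', Theta theta -> Theta theta' -> theta <> theta' ->
     exists t x u, [/\ SX t x, SU u & g t x u theta <> g t x u theta'])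
  (* (P4) *)
  (P4eq : forall x, SX12 x ->
     forall B : set R, measurable B -> kU t1 x B = kU t2 x B)
  (P4supp : forall t x, SX12 x -> support (kU t x) = SU)
  (* (C1) *)
  (C1 : forall n omega, (0 < n)%N ->
     Theta (thetahat n omega) /\
     norm_mu mu (D_hat g (obsW Y X) n omega (thetahat n omega)) =
     ereal_inf [set norm_mu mu (D_hat g (obsW Y X) n omega theta) |
                theta in Theta])
  (* (C2) *)
  (C2 : compact Theta)
  (* (C3) *)
  (C3 : exists (gbar : 'rV[R]_k -> R) (K : R),
     [/\ 0 < K, forall x, 0 < gbar x, measurable_fun [set: 'rV[R]_k] gbar,
         forall t, ('E_P[gbar \o X 0%N t] <= K%:E)%E &
         forall t x u theta theta', SX t x -> SU u -> Theta theta ->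
           Theta theta' ->
           `|g t x u theta' - g t x u theta| <=
             gbar x * euclidean_norm (theta' - theta)])
  (* (C4) *)
  (C4 : forall t, exists (f : R -> 'rV[R]_k * 'rV[R]_k -> R) (M : R),
     forall x, SX12 x ->
       [/\ forall y, 0 <= f y x <= M,
           continuous (fun y => f y x) &
           forall B : set R, measurable B ->
             kY t x B = (\int[lebesgue_measure]_(y in B) (f y x)%:E)%E])
  (* (C5) *)
  (C5 : forall t, exists (J : nat) (beta : 'I_J -> 'rV[R]_k -> R),
     forall theta u, Theta theta -> SU u ->
       exists alpha : 'rV[R]_J, forall x, SX t x ->
         g t x u theta = \sum_(j < J) alpha ord0 j * beta j x)
  (* (Identification) *)
  (Ident : forall theta, Theta theta ->
     (norm_mu mu (D_pop P g (obsW Y X 0%N) theta) = 0%E <-> theta = theta0)) :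
  {ae P, forall omega, thetahat n omega @[n --> \oo] --> theta0}.
Proof.
have [gbar [K [K0 gbar0 mgbar EK lipg]]] := C3.
(* [SX] is the support for observation 0; equality of laws on open sets carries it to every
   observation. *)
have openX t i (O : set 'rV[R]_k) : open O ->
    P (X 0%N t @^-1` O) = P (X i t @^-1` O).
  move=> oO; have mO : measurable O by exact: sub_sigma_algebra.
  have mB : measurable (regressor t @^-1` O : set ((R * R) * ('rV[R]_k * 'rV[R]_k))).
    by rewrite -[Z in measurable Z]setTI; exact: measurable_regressor.
  have XE j : X j t @^-1` O = obsW Y X j @^-1` (regressor t @^-1` O).
    by apply/seteqP; split => omega; rewrite /preimage /= regressor_obsW.
  by rewrite !XE; exact: hident.
have aeX : {ae P, forall omega, forall i t, SX t (X i t omega)}.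
  have aeit (it : nat * 'I_2) : {ae P, forall omega, SX it.2 (X it.1 it.2 omega)}.
    have := @ae_support R _ _ P _ _ _ (X it.1 it.2)
      (@metrically_dense_row R k) (fun r e _ =>
        measurable_funPTI (X it.1 it.2) (measurable_row_ball (map_mx (@ratr R) r) e)).
    apply: filterS => omega supp; rewrite hSX => O oO Ox.
    by rewrite /distribution /pushforward (openX _ it.1)//; exact: supp.
  have := ae_forall_countable aeit.
  by apply: filterS => omega h i t; exact: (h (i, t)).
have mballs (d' : measure_display) (T : measurableType d') (f1 f2 : T -> 'rV[R]_k)
    (q : 'rV[rat]_k * 'rV[rat]_k) (e : R) :
    measurable_fun setT f1 -> measurable_fun setT f2 ->
    measurable ((fun x => (f1 x, f2 x)) @^-1`
      ball (map_mx (@ratr R) q.1, map_mx (@ratr R) q.2) e).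
  move=> mf1 mf2.
  have -> : (fun x => (f1 x, f2 x)) @^-1`
      ball (map_mx (@ratr R) q.1, map_mx (@ratr R) q.2) e =
      (f1 @^-1` ball (map_mx (@ratr R) q.1) e) `&` (f2 @^-1` ball (map_mx (@ratr R) q.2) e).
    by [].
  apply: measurableI.
    by rewrite -[Z in measurable Z]setTI; apply: mf1 => //; exact: measurable_row_ball.
  by rewrite -[Z in measurable Z]setTI; apply: mf2 => //; exact: measurable_row_ball.
(* The densities in (C4) are given only on [SX12], so the kernel bound holds almost surely through
   this fact. *)
have aeX12 : {ae P, forall omega, SX12 (pairX X 0%N omega)}.
  rewrite hSX12.
  apply: (@ae_support R _ _ P _ _ _ (pairX X 0%N) (metrically_dense_prod
    (@metrically_dense_row R k) (@metrically_dense_row R k))) => q e e0.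
  exact: mballs.
have aemu : {ae mu, forall v, SU v.2}.
  have : {ae mu, forall v, support mu v}.
    apply: (@ae_support R _ _ mu _ _ _ id (metrically_dense_prod (metrically_dense_prod
      (@metrically_dense_row R k) (@metrically_dense_row R k))
      (@metrically_dense_real R))) => q e e0.
    rewrite (_ : _ @^-1` _ =
      ((fun v : ('rV[R]_k * 'rV[R]_k) * R => (v.1.1, v.1.2)) @^-1`
        ball (map_mx (@ratr R) q.1.1, map_mx (@ratr R) q.1.2) e) `&`
      (snd @^-1` ball (ratr q.2 : R) e)); last first.
      by apply/seteqP; split => -[[? ?] ?].
    apply: measurableI.
      by apply: mballs; [exact: (measurableT_comp measurable_fst measurable_fst)|
        exact: (measurableT_comp measurable_snd measurable_fst)].
    rewrite -[Z in measurable Z]setTI; apply: measurable_snd => //.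
    exact: measurable_ball.
  by rewrite hmu; apply: filterS => v [].
have [M [M0 density_le]] : exists M : R, 0 <= M /\ forall t,
    {ae P, forall omega, forall a b : R, a <= b ->
      (kY t (pairX X 0%N omega) `[a, b]%classic <= (M * (b - a))%:E)%E}.
  have [f1 [M1 h1]] := C4 t1; have [f2 [M2 h2]] := C4 t2.
  have bnd t (f : R -> 'rV[R]_k * 'rV[R]_k -> R) (M : R) x (a b : R) : 0 <= M ->
      [/\ forall y, 0 <= f y x <= M, continuous (fun y => f y x) &
         forall B : set R, measurable B ->
           kY t x B = (\int[lebesgue_measure]_(y in B) (f y x)%:E)%E] ->
      a <= b -> (kY t x `[a, b]%classic <= (M * (b - a))%:E)%E.
    move=> M0 [f0M cf ->//] ab.
    apply: (@le_trans _ _ (\int[lebesgue_measure]_(y in `[a, b]) cst M%:E y)%E).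
      apply: ge0_le_integral => //.
      - by move=> y _; rewrite lee_fin; case/andP: (f0M y).
      - apply/measurable_EFinP; apply: measurable_funTS.
        exact: continuous_measurable_fun.
      - by move=> y _; rewrite lee_fin; case/andP: (f0M y).
    rewrite integral_cst//= lebesgue_measure_itv /= lte_fin.
    case: ltP => // ba; by rewrite mule0 lee_fin mulr_ge0// subr_ge0.
  (* One bound for both periods; the absolute values make it nonnegative without exhibiting a point
     of [SX12]. *)
  exists (`|M1| + `|M2|); split; first by rewrite addr_ge0.
  have widen t (f : R -> 'rV[R]_k * 'rV[R]_k -> R) (M : R) : M <= `|M1| + `|M2| ->
      (forall x, SX12 x -> [/\ forall y, 0 <= f y x <= M,
         continuous (fun y => f y x) & forall B : set R, measurable B ->
           kY t x B = (\int[lebesgue_measure]_(y in B) (f y x)%:E)%E]) ->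
      {ae P, forall omega, forall a b : R, a <= b ->
        (kY t (pairX X 0%N omega) `[a, b]%classic
           <= ((`|M1| + `|M2|) * (b - a))%:E)%E}.
    move=> MM hf; apply: filterS aeX12 => omega /hf[f0M cf kf] a b.
    apply: (bnd t f); first by rewrite addr_ge0.
    split => // y; have /andP[-> /le_trans] := f0M y; exact.
  move=> t; case: (period_cases t) => ->.
    by apply: (widen _ f1 M1 _ h1); rewrite (le_trans (ler_norm _))// lerDl.
  by apply: (widen _ f2 M2 _ h2); rewrite (le_trans (ler_norm _))// lerDr.
apply: (@extremum_consistent R k dt d Omega P Y X g Theta SX SU mu kY gbar K M) => //.
- exact: ltW.
- by move=> theta Th; rewrite -Ident// norm_mu_eq0.
- move=> n omega n0; have [Th hmin] := C1 n omega n0; split => //.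
  by apply: le_norm_mu; rewrite hmin; apply: ereal_inf_lbound; exists theta0.
Qed.
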